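(* Let $n,m\ge 1$, $k\ge 2$ be integers, let $R_*,R'>0$, and let $$\Omega_4=D_{R_*}\times (D')^n\times\underbrace{\mathbb{C}^n\times\cdots\times\mathbb{C}^n}_{m-1},$$ where $D_r=\{z\in\mathbb{C}:|z|\le r\}$ and $D'=\{|w|\le R'\}\subset\mathbb{C}$. Let $H(z,\eta_0,\dots,\eta_{m-1}):\Omega_4\to\mathbb{C}^n$ be a mapping of class $C^k$ that is holomorphic in $\mathrm{Int}(\Omega_4)$. Let $a_0\in\mathrm{Int}((D')^n)$ and $a_1,\dots,a_{m-1}\in\mathbb{C}^n$. Then for all sufficiently small $R>0$ the holomorphic differential system $$f^{(m)}(z)=H(z,f(z),f'(z),\dots,f^{(m-1)}(z))$$ with initial values $$f(0)=a_0,\qquad f^{(i)}(0)=a_i,\quad i=1,\dots,m-1,$$ has a unique holomorphic solution $f$ on $D_R$.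
   Context: $f^{(k)}=\partial^kf$ denotes the $k$-th complex derivative of the $\mathbb{C}^n$-valued map $f$, with $\partial=\frac12(\partial_x-i\partial_y)$, $z=x+iy$. *)

(* Defs.v *)
From mathcomp Require Import all_boot all_order all_algebra.
From mathcomp Require Import complex.
From mathcomp Require Import boolp classical_sets reals.
From mathcomp Require Import topology normedtype derive.

Set Implicit Arguments.
Unset Strict Implicit.
Unset Printing Implicit Defensive.

Import Order.TTheory GRing.Theory Num.Theory.
Import numFieldNormedType.Exports.

Local Open Scope classical_set_scope.
Local Open Scope ring_scope.

(* R[i] packed as an abstract numeric field, so that the topology and norm that
   MathComp-Analysis attaches to every numFieldType are inferred for it; the
   norm of z : Cx R is the usual modulus, as a nonnegative real of Cx R. *)
Definition Cx (R : realType) : numClosedFieldType := R[i].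

Definition ofR (R : realType) (t : R) : Cx R := (t%:C)%C.

Section RealDerivatives.
Variables (R : realType) (V W : normedModType (Cx R)).

(* Difference quotient with a real increment t: this is what makes the
   derivatives below real ones, 'D_v and derivable having scalars in Cx R. *)
Definition real_quotient (f : V -> W) (p v : V) (t : R) : W :=
  ofR t^-1 *: (f (p + ofR t *: v) - f p).

Definition real_derive (v : V) (f : V -> W) (p : V) : W :=
  lim (real_quotient f p v t @[t --> 0^']).

(* Real differentiability class C^k up to the boundary: the derivatives of
   order at most k exist on the interior of A and extend continuously to A.
   Here g is the extension to A of the derivative of f along v. *)
Fixpoint class_C (k : nat) (A : set V) (f : V -> W) : Prop :=
  {within A, continuous f} /\
  if k is k'.+1 then
    forall v : V, exists2 g : V -> W, class_C k' A g &
      forall p, A° p -> real_quotient f p v t @[t --> 0^'] --> g p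
  else True.

(* Differentiability is over Cx R, hence complex; for a set A that is not open,
   f is required to be differentiable on a neighbourhood of A. *)
Definition holomorphic_on (A : set V) (f : V -> W) : Prop :=
  forall p, A p -> \forall q \near p, differentiable f q.

End RealDerivatives.

Section HolomorphicSystem.
Variables (R : realType) (m n : nat).
Local Notation C := (Cx R).

Definition disc (r : R) : set C := [set z | `|z| <= ofR r].

Definition polydisc (r : R) : set 'rV[C]_n :=
  [set w | forall j, disc r (w ord0 j)].

(* The operator (d/dx - i d/dy) / 2. *)
Definition dz (f : C -> 'rV[C]_n) (z : C) : 'rV[C]_n :=
  2^-1 *: (real_derive (1 : C) f z - 'i *: real_derive ('i : C) f z).

Definition cderiv (k : nat) (f : C -> 'rV[C]_n) : C -> 'rV[C]_n := iter k dz f.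

(* A point (eta_0, ..., eta_(m-1)) of (C^n)^m is the m x n matrix whose i-th row
   is eta_i; the row i0 is the one constrained to the polydisc. *)
Definition Omega4 (i0 : 'I_m) (Rstar R' : R) : set (C * 'M[C]_(m, n)) :=
  [set p | disc Rstar p.1 /\ polydisc R' (row i0 p.2)].

Definition jet (f : C -> 'rV[C]_n) (z : C) : 'M[C]_(m, n) :=
  \matrix_(i < m) cderiv i f z.

(* As H only matters on Om, a solution must keep its jet there. The first
   condition at i = 0 says that f is holomorphic; for 0 < i < m it says that the
   derivatives occurring in the equation exist. *)
Definition holomorphic_solution (Om : set (C * 'M[C]_(m, n)))
    (H : C * 'M[C]_(m, n) -> 'rV[C]_n) (a : 'M[C]_(m, n)) (r : R)
    (f : C -> 'rV[C]_n) : Prop :=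
  [/\ forall i : 'I_m, holomorphic_on (disc r) (cderiv i f),
      forall z, disc r z -> Om (z, jet f z),
      forall z, disc r z -> cderiv m f z = H (z, jet f z)
    & forall i : 'I_m, cderiv i f 0 = row i a].

End HolomorphicSystem.

(* Main.v *)
Require Import Defs.
From mathcomp Require Import all_boot all_order all_algebra.
From mathcomp Require Import complex.
From mathcomp Require Import boolp classical_sets reals interval_inference.
From mathcomp Require Import topology prodnormedzmodule normedtype landau derive.
From mathcomp Require Import ring lra.
Import Order.TTheory GRing.Theory Num.Theory.
Import numFieldNormedType.Exports.
Local Open Scope classical_set_scope.
Local Open Scope ring_scope.

Set Implicit Arguments.
Unset Strict Implicit.
Unset Printing Implicit Defensive.

(**
The proof avoids complex integration altogether: no Cauchy formula, no power
series, no Picard operator.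

Adding the time to the unknowns turns the system into an autonomous one,
[X' = vfield H X], for [X = (z, jet)] in the space [E] of pairs of a complex
number and an [m x n] matrix.  As [H] is of class C^2 near the initial point
[x0 = (0, a)], the mean value inequality, applied along the real coordinate
axes, shows that its complex differential is Lipschitz there; so [vfield H] has
a first-order Taylor expansion with a quadratic remainder ([C2_taylor],
[vfield_taylor]).

A solution is obtained from Euler's method with complex steps.  For [z] near 0,
let [euler z N N] be the result of [N] steps of length [z / N] from [x0].
Doubling [N] changes it by [O(1 / N)] ([euler_double]), hence it converges to
some [U z] as [N] runs over the powers of 2.  The point is that the derivative
of [U] with respect to the complex time can be read off the discrete scheme.
For two times [z] and [w], the defect
[V_j = euler w N j - euler z N j - (j / N) (w - z) G (euler z N j)]
satisfies [V_(j+1) = V_j + (w / N) D V_j + O(|w - z|^2 / N + |w - z| / N^2)],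
because the two first-order terms, [(w / N) (j / N) (w - z) D G] and
[((j + 1) / N) (w - z) (z / N) D G], agree up to an error of that size.  This
agreement rests on the complex linearity of the differential [D], that is, on the
holomorphy of the field.  A discrete Gronwall inequality bounds [V_N]
([euler_diff]), and the limit gives
[|U w - U z - (w - z) G (U z)| <= c |w - z|^2] ([holomorphic_flow]): [U] is
holomorphic and solves the equation.

Both this bound and uniqueness are made cheap by taking [rho L <= 1/2], where
[rho] is the radius of the time disc and [L] a Lipschitz constant of the field:
no exponential appears.  For uniqueness, [mean_value_barrier] is applied to the
difference of two integral curves along the ray from 0 to [z]: as long as the
difference is at most [e] its derivative is at most [e / 2], so it never exceeds
[e], and [e] is arbitrary.  The same argument keeps an arbitrary solution near
[x0] without any a priori information on where its jet goes.
*)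

(** * Real-valued norms on complex normed spaces *)

Section Norm.
Variable R : realType.
Local Notation C := (Cx R).

(** The norm of a complex normed space takes values in the complex
    numbers, whose order is partial; its real part is the same number in the
    ordered field [R], where the arithmetic decision procedures apply. *)
Definition nrm (V : normedModType C) (x : V) : R := complex.Re `|x|.

Lemma ofR_le (s t : R) : (ofR s <= ofR t) = (s <= t).
Proof. by rewrite /ofR lecR. Qed.
Lemma ofR_lt (s t : R) : (ofR s < ofR t) = (s < t).
Proof. by rewrite /ofR ltcR. Qed.
Lemma ofRD (s t : R) : ofR (s + t) = ofR s + ofR t.
Proof. exact: (rmorphD (real_complex R)). Qed.
Lemma ofRB (s t : R) : ofR (s - t) = ofR s - ofR t.
Proof. exact: (rmorphB (real_complex R)). Qed.
Lemma ofRM (s t : R) : ofR (s * t) = ofR s * ofR t.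
Proof. exact: (rmorphM (real_complex R)). Qed.
Lemma ofRV (s : R) : ofR s^-1 = (ofR s)^-1.
Proof. exact: (fmorphV (real_complex R)). Qed.
Lemma ofR0 : ofR 0 = 0 :> C. Proof. by []. Qed.
Lemma ofR1 : ofR 1 = 1 :> C. Proof. by []. Qed.
Lemma ofR_nat k : ofR (k%:R : R) = k%:R.
Proof. exact: (rmorph_nat (real_complex R)). Qed.
Lemma ofR_eq0 (s : R) : (ofR s == 0) = (s == 0).
Proof. exact: (fmorph_eq0 (real_complex R)). Qed.

Lemma nrmE (V : normedModType C) (x : V) : `|x| = ofR (nrm x).
Proof. by rewrite /ofR /nrm (RRe_real (normr_real x)). Qed.

Lemma nrm_le (V : normedModType C) (x : V) e : (`|x| <= ofR e) = (nrm x <= e).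
Proof. by rewrite nrmE ofR_le. Qed.
Lemma nrm_lt (V : normedModType C) (x : V) e : (`|x| < ofR e) = (nrm x < e).
Proof. by rewrite nrmE ofR_lt. Qed.

Lemma nrm_ge0 (V : normedModType C) (x : V) : 0 <= nrm x.
Proof. by rewrite -ofR_le -nrmE normr_ge0. Qed.
Lemma nrm0 (V : normedModType C) : nrm (0 : V) = 0.
Proof. by rewrite /nrm normr0. Qed.
Lemma nrmN (V : normedModType C) (x : V) : nrm (- x) = nrm x.
Proof. by rewrite /nrm normrN. Qed.
Lemma nrmD (V : normedModType C) (x y : V) : nrm (x + y) <= nrm x + nrm y.
Proof. by rewrite -ofR_le ofRD -!nrmE ler_normD. Qed.
Lemma nrmBC (V : normedModType C) (x y : V) : nrm (x - y) = nrm (y - x).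
Proof. by rewrite -nrmN opprB. Qed.
Lemma nrmB (V : normedModType C) (x y : V) : nrm (x - y) <= nrm x + nrm y.
Proof. by rewrite -(nrmN y) nrmD. Qed.
Lemma nrmZ (V : normedModType C) (c : C) (x : V) : nrm (c *: x) = nrm c * nrm x.
Proof.
apply/eqP; rewrite -(inj_eq (@complexI R)); apply/eqP.
by rewrite -!/(ofR _) ofRM -!nrmE normrZ.
Qed.
Lemma nrmM (c d : C) : nrm (c * d) = nrm c * nrm d.
Proof. exact: nrmZ. Qed.
Lemma nrm_ofR (t : R) : nrm (ofR t : C) = `|t|.
Proof.
apply/eqP; rewrite -(inj_eq (@complexI R)); apply/eqP.
by rewrite -!/(ofR _) -nrmE /ofR normc_def /= expr0n addr0 sqrtr_sqr.
Qed.
Lemma nrm_nat k : nrm (k%:R : C) = k%:R.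
Proof. by rewrite -ofR_nat nrm_ofR normr_nat. Qed.
Lemma nrmV_nat k : nrm ((k%:R : C)^-1) = k%:R^-1.
Proof. by rewrite -ofR_nat -ofRV nrm_ofR ger0_norm// invr_ge0. Qed.
Lemma nrm_le0 (V : normedModType C) (x : V) : nrm x <= 0 -> x = 0.
Proof. by rewrite -ofR_le -nrmE normr_le0 => /eqP. Qed.

Lemma nbhs_nrm (V : normedModType C) (p : V) (P : set V) :
  nbhs p P <-> exists2 e : R, 0 < e & forall q, nrm (q - p) < e -> P q.
Proof.
split => [/nbhs_ballP[e /= e0 eP]|[e e0 eP]]; last apply/nbhs_ballP.
  have er : e = ofR (complex.Re e).
    by rewrite /ofR (RRe_real (gtr0_real e0)).
  exists (complex.Re e); first by rewrite -ofR_lt -er.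
  move=> q qe; apply: eP; rewrite -ball_normE /ball_/= er nrm_lt.
  by rewrite nrmBC.
exists (ofR e); first by rewrite /= -ofR0 ofR_lt.
by move=> q; rewrite -ball_normE /ball_/= nrm_lt nrmBC => /eP.
Qed.

End Norm.

(** * A decision procedure for linear identities between vectors *)

Section ModuleExpressions.
Variables (K : comRingType) (V : lmodType K).

(** Reified vectors: two expressions are equal as soon as each atom has the same
    coefficient in both, which leaves one scalar identity per atom. *)
Inductive mexpr :=
| MVar of nat | MZero | MAdd of mexpr & mexpr | MOpp of mexpr | MScale of K & mexpr.

Fixpoint meval (vs : seq V) (e : mexpr) : V :=
  match e with
  | MVar i => nth 0 vs i
  | MZero => 0
  | MAdd a b => meval vs a + meval vs b
  | MOpp a => - meval vs a
  | MScale c a => c *: meval vs a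
  end.

Fixpoint mcoef (e : mexpr) (i : nat) : K :=
  match e with
  | MVar j => if Nat.eqb i j then 1 else 0
  | MZero => 0
  | MAdd a b => mcoef a i + mcoef b i
  | MOpp a => - mcoef a i
  | MScale c a => c * mcoef a i
  end.

Lemma meval_coef vs e :
  meval vs e = \sum_(i < size vs) mcoef e i *: nth 0 vs i.
Proof.
elim: e => /= [j||a -> b ->|a ->|c a ->].
- have E (i : 'I_(size vs)) :
    (if Nat.eqb i j then 1 else 0 : K) *: nth 0 vs i =
    if (i : nat) == j then nth 0 vs i else 0.
    rewrite (_ : Nat.eqb i j = (i == j :> nat)); last by elim: (i : nat) j => [|? IH] [].
    by case: eqP; rewrite ?scale1r ?scale0r.
  rewrite (eq_bigr _ (fun i _ => E i)) -big_mkcond /=.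
  have [jv|jv] := ltnP j (size vs); last first.
    rewrite nth_default// big_pred0// => i; apply/eqP => ij.
    by have := ltn_ord i; rewrite ij ltnNge jv.
  by rewrite (big_pred1 (Ordinal jv)).
- by rewrite big1// => i _; rewrite scale0r.
- by rewrite -big_split; apply: eq_bigr => i _; rewrite scalerDl.
- by rewrite -sumrN; apply: eq_bigr => i _; rewrite scaleNr.
- by rewrite scaler_sumr; apply: eq_bigr => i _; rewrite scalerA.
Qed.

Fixpoint mcoef_eq (a b : mexpr) (n : nat) : Prop :=
  if n is n'.+1 then mcoef a n' = mcoef b n' /\ mcoef_eq a b n' else True.

Lemma meval_eq vs a b : mcoef_eq a b (size vs) -> meval vs a = meval vs b.
Proof.
move=> H; rewrite !meval_coef; apply: eq_bigr => i _; congr (_ *: _).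
case: i => i /=; elim: (size vs) H => //= n IH [ab H].
by rewrite ltnS leq_eqVlt => /predU1P[->//|]; apply: IH.
Qed.

End ModuleExpressions.

Ltac mod_in x vs :=
  lazymatch vs with
  | context [x :: _] => constr:(true)
  | _ => constr:(false)
  end.
Ltac mod_atoms t vs :=
  lazymatch t with
  | (?a + ?b)%R => let vs := mod_atoms a vs in mod_atoms b vs
  | (- ?a)%R => mod_atoms a vs
  | (?c *: ?a)%R => mod_atoms a vs
  | 0%R => vs
  | _ => let b := mod_in t vs in
         lazymatch b with true => vs | false => constr:(t :: vs) end
  end.
Ltac mod_index x vs :=
  lazymatch vs with
  | x :: _ => constr:(O)
  | _ :: ?t => let i := mod_index x t in constr:(S i)
  end.
Ltac mod_quote K t vs :=
  lazymatch t with
  | (?a + ?b)%R => let a := mod_quote K a vs in let b := mod_quote K b vs in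
                   constr:(MAdd a b)
  | (- ?a)%R => let a := mod_quote K a vs in constr:(MOpp a)
  | (?c *: ?a)%R => let a := mod_quote K a vs in constr:(@MScale K c a)
  | 0%R => constr:(MZero K)
  | _ => let i := mod_index t vs in constr:(MVar K i)
  end.
(* Proves an equation between vectors over the ring [K], by collecting the
   coefficients of its atoms and comparing them with [ring] or [field]. *)
Ltac module K :=
  lazymatch goal with
  | |- @eq ?V ?a ?b =>
    let vs := mod_atoms a (@nil V) in
    let vs := mod_atoms b vs in
    let ea := mod_quote K a vs in
    let eb := mod_quote K b vs in
    apply: (@meval_eq K _ vs ea eb); rewrite /=;
    repeat (split; first by [ring|field]); exact: I
  end.

(** * Curves and the mean value inequality *)
Section Curves.
Variables (R : realType) (E : normedModType (Cx R)).
Local Notation C := (Cx R).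

Definition curve_deriv (c : R -> E) (t : R) (d : E) : Prop :=
  forall e, 0 < e -> exists2 h, 0 < h & forall s, `|s - t| < h ->
    nrm (c s - c t - ofR (s - t) *: d) <= e * `|s - t|.

Lemma curve_growth (c : R -> E) t d e : curve_deriv c t d -> 0 < e ->
  exists2 h, 0 < h & forall s, `|s - t| < h ->
    nrm (c s - c t) <= (nrm d + e) * `|s - t|.
Proof.
move=> cd e0; have [h h0 ch] := cd e e0; exists h => // s /ch cs.
have -> : c s - c t = (c s - c t - ofR (s - t) *: d) + ofR (s - t) *: d.
  by rewrite subrK.
apply: (le_trans (nrmD _ _)); rewrite nrmZ nrm_ofR; nra.
Qed.

(** If the derivative is at most [M < r] whenever the curve is in the ball of
    radius [r], then the curve cannot leave this ball before time 1.  Real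
    induction on the property [nrm (c s) <= r * s]: the supremum [T] of the times
    up to which it holds is attained by continuity, and if [T < 1] then
    [nrm (c T) <= r], so the slope at [T] is at most [M < r] and the property
    extends beyond [T].  The hypothesis on the derivative is conditional so that
    the lemma serves as a Gronwall inequality as well. *)
Lemma mean_value_barrier (c : R -> E) (M r : R) :
  0 <= M < r -> c 0 = 0 ->
  (forall t, 0 <= t <= 1 -> exists2 d, curve_deriv c t d &
     nrm (c t) <= r -> nrm d <= M) ->
  nrm (c 1) <= r.
Proof.
move=> /andP[M0 Mr] c0 cd.
pose S := [set t : R | 0 <= t <= 1 /\ forall s, 0 <= s <= t -> nrm (c s) <= r * s].
have S0 : S 0.
  split=> [|s s0]; first by rewrite lexx ler01.
  have -> : s = 0 by lra.
  by rewrite c0 nrm0 mulr0.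
have S1 : ubound S 1 by move=> t [/andP[]].
have hS : has_sup S by split; [exists 0 | exists 1].
set T := sup S.
have T0 : 0 <= T by apply: ub_le_sup => //; exists 1.
have T1 : T <= 1 by apply: ge_sup => //; exists 0.
have ltT s : 0 <= s < T -> nrm (c s) <= r * s.
  move=> /andP[s0 sT]; have [|t [t01 tS] st] := sup_adherent (eps := T - s) _ hS.
    by rewrite subr_gt0.
  apply: tS; rewrite s0 /=; apply: ltW; rewrite -/T in st; lra.
have [|d dT dM] := cd T; first by rewrite T0.
have leT : nrm (c T) <= r * T.
  have [->|Tn0] := eqVneq T 0; first by rewrite c0 nrm0 mulr0.
  have {Tn0}Tpos : 0 < T by rewrite lt_def Tn0.
  have [h h0 hT] := curve_growth dT ltr01.
  set k := nrm d + 1 in hT.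
  have k0 : 0 < k by have := nrm_ge0 d; rewrite /k; lra.
  apply/ler_addgt0Pr => e e0.
  pose u := Num.min (Num.min (h / 2) T) (e / k).
  have u0 : 0 < u by rewrite !lt_min Tpos !divr_gt0.
  have uh : u < h by rewrite !gt_min; apply/orP; left; apply/orP; left; lra.
  have uT : u <= T by rewrite !ge_min lexx !orbT.
  have ue : u * k <= e by rewrite -ler_pdivlMr// ge_min lexx orbT.
  have /hT : `|T - u - T| < h by rewrite addrC addKr normrN gtr0_norm.
  rewrite (_ : T - u - T = - u); last by ring.
  rewrite normrN (gtr0_norm u0) => cTu.
  have cu : nrm (c (T - u)) <= r * (T - u).
    by apply: ltT; rewrite subr_ge0 uT/= ltrBlDr ltrDl.
  have -> : c T = c (T - u) - (c (T - u) - c T) by rewrite opprB addrC subrK.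
  apply: (le_trans (nrmB _ _)); nra.
have TS : S T.
  split=> [|s /andP[s0]]; first by rewrite T0.
  by rewrite le_eqVlt => /predU1P[->//|sT]; apply: ltT; rewrite s0.
have [T1'|T1'] := eqVneq T 1.
  by move: leT; rewrite T1' mulr1.
have {T1' T1}T1 : T < 1 by rewrite lt_neqAle T1'.
have [h h0 hT] := curve_growth (e := r - M) dT (ltac:(lra)).
have {}dM : nrm d <= M by apply: dM; nra.
pose u := Num.min (h / 2) (1 - T).
have u0 : 0 < u by rewrite lt_min; apply/andP; split; lra.
have uh : u < h by rewrite gt_min; apply/orP; left; lra.
have uT : u <= 1 - T by rewrite ge_min lexx orbT.
suff : S (T + u) by move=> /(ub_le_sup (ex_intro _ 1 S1)); rewrite -/T; lra.
split=> [|s /andP[s0 su]]; first by lra.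
have [sT|Ts] := ltP s T; first by apply: ltT; rewrite s0.
have sT0 : `|s - T| = s - T by rewrite ger0_norm// subr_ge0.
have := hT s; rewrite sT0 => /(_ ltac:(lra)) cs.
have -> : c s = c T + (c s - c T) by rewrite addrC subrK.
apply: (le_trans (nrmD _ _)).
nra.
Qed.

Lemma curve_derivB (b c : R -> E) t d e :
  curve_deriv b t d -> curve_deriv c t e ->
  curve_deriv (fun s => b s - c s) t (d - e).
Proof.
move=> bd ce k k0.
have k20 : 0 < k / 2 by lra.
have [h1 h10 H1] := bd _ k20; have [h2 h20 H2] := ce _ k20.
exists (Num.min h1 h2) => [|s]; first by rewrite lt_min h10.
rewrite lt_min => /andP[/H1 B1 /H2 B2].
have -> : b s - c s - (b t - c t) - ofR (s - t) *: (d - e) =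
  (b s - b t - ofR (s - t) *: d) - (c s - c t - ofR (s - t) *: e).
  by module (Cx R).
by apply: (le_trans (nrmB _ _)); lra.
Qed.

Lemma mean_value (c : R -> E) (M : R) : 0 <= M ->
  (forall t, 0 <= t <= 1 -> exists2 d, curve_deriv c t d & nrm d <= M) ->
  nrm (c 1 - c 0) <= M.
Proof.
move=> M0 cd; apply/ler_addgt0Pr => e e0.
apply: (@mean_value_barrier (fun t => c t - c 0) M).
- by rewrite M0 ltrDl.
- by rewrite subrr.
move=> t /cd[d td dM]; exists d => // k /td[h h0 H]; exists h => // s /H.
by rewrite opprB addrA subrK.
Qed.

End Curves.

(** * Limits of geometrically convergent sequences *)
Section Completeness.
Variable R : realType.
Local Notation C := (Cx R).

(** The form of completeness that the dyadic Euler approximations need; it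
    passes from the reals to the complex numbers, matrices and products. *)
Definition geometrically_complete (V : normedModType C) : Prop :=
  forall (u : nat -> V) (c : R),
    (forall i, nrm (u i.+1 - u i) <= c / 2 ^+ i) ->
    exists (l : V) (d : R), forall i, nrm (u i - l) <= d / 2 ^+ i.

(** The corrected sequences [u i - 2 c / 2^i] and [u i + 2 c / 2^i] are monotone
    in opposite directions, so the supremum of the first lies between them. *)
Lemma real_geometric_limit (u : nat -> R) (c : R) :
  (forall i, `|u i.+1 - u i| <= c / 2 ^+ i) ->
  exists l, forall i, `|u i - l| <= 2 * c / 2 ^+ i.
Proof.
move=> uc.
have c0 : 0 <= c by have := uc 0; rewrite expr0 divr1; apply: le_trans.
pose e i := c / 2 ^+ i.
have e0 i : 0 <= e i by rewrite divr_ge0// exprn_ge0.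
have eS i : e i = 2 * e i.+1.
  by rewrite /e exprS; field; rewrite expf_neq0// pnatr_eq0.
have inc i : u i - 2 * e i <= u i.+1 - 2 * e i.+1.
  by have := uc i; rewrite -/(e i) ler_norml => /andP[]; have := eS i; lra.
have dec i : u i.+1 + 2 * e i.+1 <= u i + 2 * e i.
  by have := uc i; rewrite -/(e i) ler_norml => /andP[]; have := eS i; lra.
have incm i k : u i - 2 * e i <= u (k + i)%N - 2 * e (k + i)%N.
  by elim: k => // k IH; apply: le_trans IH (inc _).
have decm i k : u (k + i)%N + 2 * e (k + i)%N <= u i + 2 * e i.
  by elim: k => // k IH; apply: le_trans (dec _) IH.
have cross i j : u i - 2 * e i <= u j + 2 * e j.
  apply: (le_trans (incm i j)); apply: (le_trans _ (decm j i)).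
  by rewrite addnC; have := e0 (i + j)%N; lra.
pose S := [set x | exists i, x = u i - 2 * e i].
have S0 : S !=set0 by exists (u 0 - 2 * e 0); exists 0.
have Sub j : ubound S (u j + 2 * e j) by move=> _ [i ->].
exists (sup S) => i; rewrite -mulrA -/(e i) ler_norml.
have l1 : u i - 2 * e i <= sup S.
  by apply: ub_le_sup; [exists (u 0 + 2 * e 0) | exists i].
have l2 : sup S <= u i + 2 * e i by apply: ge_sup.
by apply/andP; split; lra.
Qed.

Lemma nrm_Re (z : C) : `|complex.Re z| <= nrm z.
Proof. by rewrite -ofR_le -nrmE; apply: normc_ge_Re. Qed.

Lemma nrm_Im (z : C) : `|complex.Im z| <= nrm z.
Proof.
case: z => x y; rewrite -ofR_le -nrmE normc_def /= ofR_le -sqrtr_sqr.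
by rewrite ler_sqrt ?addr_ge0 ?sqr_ge0// lerDr sqr_ge0.
Qed.

Lemma ReImE (z : C) : z = ofR (complex.Re z) + 'i * ofR (complex.Im z).
Proof. by rewrite {1}[z]complexE complexiE. Qed.

Lemma nrm_i : nrm ('i : C) = 1.
Proof. by apply/eqP; rewrite /nrm normCi. Qed.

Lemma nrm_ReIm (z : C) : nrm z <= `|complex.Re z| + `|complex.Im z|.
Proof.
rewrite {1}[z]ReImE; apply: (le_trans (nrmD _ _)).
by rewrite nrmM nrm_i mul1r !nrm_ofR.
Qed.

Lemma complex_complete : geometrically_complete C.
Proof.
move=> u c uc.
have [|x xu] := @real_geometric_limit (fun i => complex.Re (u i)) c.
  by move=> i; apply: le_trans (uc i); rewrite -raddfB nrm_Re.
have [|y yu] := @real_geometric_limit (fun i => complex.Im (u i)) c.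
  by move=> i; apply: le_trans (uc i); rewrite -raddfB nrm_Im.
exists (x +i* y)%C, (4 * c) => i.
apply: (le_trans (nrm_ReIm _)); rewrite !raddfB /=.
by have := xu i; have := yu i; lra.
Qed.

End Completeness.

(** * Complex Euler polygons *)
Section Euler.
Variables (R : realType) (E : normedModType (Cx R)).
Local Notation C := (Cx R).

(** The growth rate [1 / 2] per unit of time is small enough for a linear bound
    to be self-reproducing: if [x j <= 2 k] then [x] grows by at most
    [(k + k) / N] at the next step. *)
Lemma discrete_gronwall (x : nat -> R) (N : nat) (k : R) : 0 <= k -> x 0 <= 0 ->
  (forall j, (j < N)%N -> x j.+1 <= x j + (2^-1 * x j + k) / N%:R) ->
  forall j, (j <= N)%N -> x j <= 2 * k * (j%:R / N%:R).
Proof.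
move=> k0 x0 xS; elim=> [|j IH] jN; first by rewrite mul0r mulr0.
have N0 : 0 < N%:R :> R by rewrite ltr0n; apply: leq_trans jN.
have {}IH := IH (ltnW jN).
apply: (le_trans (xS j jN)).
have jN1 : j%:R / N%:R <= 1 :> R by rewrite ler_pdivrMr// mul1r ler_nat ltnW.
have : (2^-1 * x j + k) / N%:R <= (2 * k) / N%:R.
  by rewrite ler_pM2r ?invr_gt0//; nra.
by rewrite -(natr1 j) [(_ + 1) / _]mulrDl mul1r mulrDr; lra.
Qed.

Lemma le_lim_pow2 (x y c : R) :
  (forall i, x <= y + c / 2 ^+ i) -> x <= y.
Proof.
move=> H; apply/ler_addgt0Pr => e e0.
have [c0|c0] := leP c 0.
  apply: (le_trans (H 0)); rewrite expr0 divr1; lra.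
have [i ci] : exists i : nat, c / e < i%:R.
  by exists (Num.bound (c / e)); apply: archi_boundP; rewrite divr_ge0 // ltW.
apply: (le_trans (H i)); rewrite lerD2l ler_pdivrMr ?exprn_gt0//.
have : i%:R <= 2 ^+ i :> R by rewrite -natrX ler_nat ltnW// ltn_expl.
move: ci; rewrite ltr_pdivrMr//; nra.
Qed.

(* [G] is the vector field and [D x] its differential at [x], Lipschitz in the
   sense of [GT]; complex linearity of [D x] is [DD] and [DZ]. *)
Variables (G : E -> E) (D : E -> E -> E) (X0 : E) (r M L K rho : R).
Local Notation near0 x := (nrm (x - X0) <= r).
Hypotheses (M0 : 0 <= M) (L0 : 0 <= L) (K0 : 0 <= K) (rho0 : 0 < rho).
Hypothesis GM : forall x, near0 x -> nrm (G x) <= M.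
Hypothesis GL : forall x y, near0 x -> near0 y ->
  nrm (G y - G x) <= L * nrm (y - x).
Hypothesis GT : forall x y, near0 x -> near0 y ->
  nrm (G y - G x - D x (y - x)) <= K * nrm (y - x) ^+ 2.
Hypothesis DD : forall x u v, near0 x -> D x (u + v) = D x u + D x v.
Hypothesis DZ : forall x c u, near0 x -> D x (c *: u) = c *: D x u.
Hypothesis DL : forall x u, near0 x -> nrm (D x u) <= L * nrm u.
Hypotheses (rhoM : rho * M <= r) (rhoL : rho * L <= 2^-1).

Definition euler (z : C) (N j : nat) : E :=
  iter j (fun x => x + (z / N%:R) *: G x) X0.

Lemma eulerS z N j :
  euler z N j.+1 = euler z N j + (z / N%:R) *: G (euler z N j).
Proof. by []. Qed.

Lemma nrm_step (z : C) N : nrm (z / N%:R) = nrm z / N%:R.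
Proof. by rewrite nrmM nrmV_nat. Qed.

Lemma euler_bound z N j : nrm z <= rho -> (j <= N)%N ->
  nrm (euler z N j - X0) <= rho * M.
Proof.
move=> zr jN.
suff : forall j, (j <= N)%N ->
  nrm (euler z N j - X0) <= rho * M * (j%:R / N%:R).
  move=> /(_ j jN) /le_trans; apply; rewrite ler_piMr ?mulr_ge0 ?(ltW rho0)//.
  have [->|N0] := posnP N; first by rewrite invr0 mulr0.
  by rewrite ler_pdivrMr ?ltr0n// mul1r ler_nat.
elim=> {jN}[|{}j IH] jN; first by rewrite subrr nrm0 mul0r mulr0.
have N0 : 0 < N%:R :> R by rewrite ltr0n; apply: leq_trans jN.
have {}IH := IH (ltnW jN).
have jN1 : j%:R / N%:R <= 1 :> R by rewrite ler_pdivrMr// mul1r ler_nat ltnW.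
have jN0 : 0 <= j%:R / N%:R :> R by rewrite divr_ge0.
have box : near0 (euler z N j).
  apply: (le_trans IH); apply: le_trans rhoM.
  by rewrite ler_piMr// mulr_ge0// ltW.
rewrite eulerS addrAC; apply: (le_trans (nrmD _ _)).
rewrite nrmZ nrm_step -(natr1 j) [(_ + 1) / _]mulrDl mul1r mulrDr lerD//.
rewrite mulrAC ler_wpM2r ?invr_ge0//.
by rewrite ler_pM ?nrm_ge0// GM.
Qed.

Lemma euler_box z N j : nrm z <= rho -> (j <= N)%N -> near0 (euler z N j).
Proof. by move=> zr jN; apply: le_trans rhoM; apply: euler_bound. Qed.

Lemma euler_lip z w N j : nrm z <= rho -> nrm w <= rho -> (j <= N)%N ->
  nrm (euler w N j - euler z N j) <= 2 * (M * nrm (w - z)).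
Proof.
move=> zr wr jN.
have k0 : 0 <= M * nrm (w - z) by rewrite mulr_ge0 ?nrm_ge0.
have := discrete_gronwall (x := fun j => nrm (euler w N j - euler z N j))
  (N := N) k0 _ _ jN.
rewrite subrr nrm0 => /(_ (lexx _)) H.
apply: (le_trans (H _)); last first.
  rewrite ler_piMr ?mulr_ge0 ?nrm_ge0//.
  have [->|N0] := posnP N; first by rewrite invr0 mulr0.
  by rewrite ler_pdivrMr ?ltr0n// mul1r ler_nat.
move=> {H jN}{}j jN; set x := euler z N j; set y := euler w N j.
rewrite !eulerS -/x -/y.
have Bx : near0 x by apply: euler_box => //; exact: ltnW.
have By : near0 y by apply: euler_box => //; exact: ltnW.
have -> : y + (w / N%:R) *: G y - (x + (z / N%:R) *: G x) =
  (y - x) + (N%:R^-1 : C) *: (w *: (G y - G x) + (w - z) *: G x).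
  by module (Cx R).
apply: (le_trans (nrmD _ _)); rewrite lerD2l nrmZ nrmV_nat mulrC.
rewrite ler_wpM2r ?invr_ge0//.
apply: (le_trans (nrmD _ _)); rewrite !nrmZ.
apply: lerD; last by rewrite [leRHS]mulrC ler_wpM2l ?nrm_ge0// GM.
apply: (@le_trans _ _ (rho * (L * nrm (y - x)))).
  by rewrite ler_pM ?nrm_ge0// GL.
by rewrite mulrA ler_wpM2r ?nrm_ge0.
Qed.

Lemma half_step (z : C) N : nrm (z / (2 * N)%:R) = nrm z / 2 / N%:R.
Proof. by rewrite nrm_step natrM invfM mulrA. Qed.

(** Two half steps differ from one full step by the variation of [G] over a half
    step, which is [O(1 / N)], times the step length. *)
Lemma euler_double z N : nrm z <= rho -> (0 < N)%N ->
  nrm (euler z (2 * N) (2 * N) - euler z N N) <= 2 * (rho * (L * (rho * M))) / N%:R.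
Proof.
move=> zr N0; have N0' : 0 < N%:R :> R by rewrite ltr0n.
set k := rho * (L * (rho * M)) / N%:R.
have rM0 : 0 <= rho * M by rewrite mulr_ge0// ltW.
have k0 : 0 <= k.
  by apply: divr_ge0 => //; apply: mulr_ge0; rewrite ?(ltW rho0)// mulr_ge0.
have := @discrete_gronwall (fun j => nrm (euler z (2 * N) (2 * j) - euler z N j))
  N k k0 _ _ N (leqnn N).
rewrite muln0 subrr nrm0 divff ?gt_eqF// mulr1 => /(_ (lexx _)) H.
rewrite -mulrA; apply: H => j jN.
have Bx : near0 (euler z N j) by apply: euler_box => //; exact: ltnW.
have BX : near0 (euler z (2 * N) (2 * j)).
  by apply: euler_box => //; rewrite leq_mul2l /= ltnW.
have BX' : near0 (euler z (2 * N) (2 * j).+1).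
  by apply: euler_box => //; rewrite ltn_mul2l.
rewrite mulnS; set x := euler z N j in Bx *.
set X := euler z (2 * N) (2 * j) in BX *.
rewrite !eulerS -/x in BX' *; rewrite -/X in BX' *.
set h := z / (2 * N)%:R in BX' *.
have hN : nrm h = nrm z / 2 / N%:R := half_step z N.
set X' := X + h *: G X in BX' *.
(* As [z / N = 2 h], the two half steps from [X] make a full step up to the
   variation of [G] between [X] and the midpoint [X']. *)
have -> : X' + h *: G X' - (x + (z / N%:R) *: G x) =
   X - x + ((z / N%:R) *: (G X - G x) + h *: (G X' - G X)).
  have -> : z / N%:R = 2 * h.
    rewrite /h natrM; field.
    by rewrite !pnatr_eq0 -lt0n N0.
  by rewrite /X'; module (Cx R).
apply: (le_trans (nrmD _ _)); rewrite lerD2l.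
apply: (le_trans (nrmD _ _)); rewrite nrmZ (nrmZ h) hN nrm_step.
have {}BX' := GL BX BX'; have {}Bx := GL Bx BX.
have XX : X' - X = h *: G X by rewrite /X' addrAC subrr add0r.
rewrite XX nrmZ hN in BX'.
have {}BX := GM BX.
have iN0 : 0 <= N%:R^-1 :> R by rewrite invr_ge0.
rewrite [leRHS]mulrDl mulrAC lerD//.
  rewrite ler_wpM2r//.
  apply: (@le_trans _ _ (rho * (L * nrm (X - x)))).
    by rewrite ler_pM ?nrm_ge0.
  by rewrite mulrA ler_wpM2r ?nrm_ge0.
rewrite mulrAC ler_wpM2r// /k.
have : nrm z / 2 * nrm (G X' - G X) <= rho * (L * (rho * N%:R^-1 * M)).
  rewrite ler_pM ?nrm_ge0 ?divr_ge0 ?nrm_ge0//.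
    by have := nrm_ge0 z; lra.
  apply: (le_trans BX'); rewrite ler_wpM2l// ler_pM ?nrm_ge0//.
    by rewrite !mulr_ge0 ?nrm_ge0// invr_ge0.
  by rewrite ler_wpM2r//; have := nrm_ge0 z; lra.
by rewrite (_ : rho * (L * (rho * N%:R^-1 * M)) = rho * (L * (rho * M)) / N%:R)//; ring.
Qed.

(** The discrete form of the complex differentiability of the flow.  The defect
    [V] below vanishes at 0; in its increment the terms of first order in
    [w - z] cancel, up to [(w - z) (j (w - z) - z) / N^2], thanks to the complex
    linearity of [D x]. *)
Lemma euler_diff z w N : nrm z <= rho -> nrm w <= rho -> (0 < N)%N ->
  nrm (euler w N N - euler z N N - (w - z) *: G (euler z N N)) <=
  2 * ((4 * rho * K * M ^+ 2 + L * M) * nrm (w - z) ^+ 2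
     + (rho * L * M + K * (rho * M) ^+ 2) * nrm (w - z) / N%:R).
Proof.
move=> zr wr N0; have N0' : 0 < N%:R :> R by rewrite ltr0n.
have NC : (N%:R : C) != 0 by rewrite pnatr_eq0 -lt0n.
set k := (X in _ <= 2 * X).
have rM0 : 0 <= rho * M by rewrite mulr_ge0// ltW.
have k0 : 0 <= k.
  rewrite /k addr_ge0// ?divr_ge0// ?mulr_ge0// ?addr_ge0 ?mulr_ge0//
    ?exprn_ge0 ?nrm_ge0 ?(ltW rho0)//.
pose V j := euler w N j - euler z N j - (j%:R / N%:R * (w - z)) *: G (euler z N j).
have := @discrete_gronwall (fun j => nrm (V j)) N k k0 _ _ N (leqnn N).
rewrite divff ?gt_eqF// mulr1 {1}/V mul0r mul0r scale0r subr0 subrr nrm0.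
have -> : V N = euler w N N - euler z N N - (w - z) *: G (euler z N N).
  by rewrite /V divff// mul1r.
move=> /(_ (lexx _)); apply => j jN.
have Bx : near0 (euler z N j) by apply: euler_box => //; exact: ltnW.
have By : near0 (euler w N j) by apply: euler_box => //; exact: ltnW.
have Bx' : near0 (euler z N j.+1) by apply: euler_box.
have xy := euler_lip zr wr (ltnW jN).
have Vy : euler w N j - euler z N j =
  V j + (j%:R / N%:R * (w - z)) *: G (euler z N j) by rewrite subrK.
have R1 := GT Bx By; have R2 := GT Bx Bx'.
rewrite {1}Vy DD// DZ// in R1.
have xx' : euler z N j.+1 - euler z N j = (z / N%:R) *: G (euler z N j).
  by rewrite eulerS addrC addKr.
rewrite xx' DZ// in R2.
(* The four terms: Taylor remainder between the two polygons, propagation of the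
   defect, uncancelled part of the first-order terms, Taylor remainder along one
   step of the polygon of [z]. *)
have -> : V j.+1 = V j + (N%:R^-1 : C) *:
  (w *: (G (euler w N j) - G (euler z N j)
         - (D (euler z N j) (V j) + (j%:R / N%:R * (w - z)) *: D (euler z N j) (G (euler z N j))))
   + w *: D (euler z N j) (V j)
   + ((w - z) / N%:R * (j%:R * (w - z) - z)) *: D (euler z N j) (G (euler z N j))
   - (j.+1%:R * (w - z)) *: (G (euler z N j.+1) - G (euler z N j)
         - (z / N%:R) *: D (euler z N j) (G (euler z N j)))).
  rewrite /V !eulerS -(natr1 j); module (Cx R).
apply: (le_trans (nrmD _ _)); rewrite lerD2l nrmZ nrmV_nat mulrC.
rewrite ler_wpM2r ?invr_ge0//.
set g := G (euler z N j) in xx' R1 R2 Vy *.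
set x := euler z N j in Bx xx' R1 R2 Vy *.
have gM : nrm g <= M := GM Bx.
have gM0 := nrm_ge0 g; have h0 := nrm_ge0 (w - z); have z0 := nrm_ge0 z.
have iN0 : 0 <= N%:R^-1 :> R by rewrite invr_ge0.
apply: (le_trans (nrmB _ _)); apply: (le_trans (lerD (nrmD _ _) (lexx _))).
apply: (le_trans (lerD (lerD (nrmD _ _) (lexx _)) (lexx _))).
rewrite !nrmZ.
have B1 : nrm w * nrm (G (euler w N j) - g
    - (D x (V j) + (j%:R / N%:R * (w - z)) *: D x g))
    <= rho * (K * (2 * (M * nrm (w - z))) ^+ 2).
  rewrite ler_pM ?nrm_ge0//; apply: (le_trans R1).
  by rewrite ler_wpM2l// lerXn2r ?nnegrE ?nrm_ge0// mulr_ge0// mulr_ge0.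
have B2 : nrm w * nrm (D x (V j)) <= 2^-1 * nrm (V j).
  apply: (@le_trans _ _ (rho * (L * nrm (V j)))).
    by rewrite ler_pM ?nrm_ge0// DL.
  by rewrite mulrA ler_wpM2r ?nrm_ge0.
have B3 : nrm ((w - z) / N%:R * (j%:R * (w - z) - z)) * nrm (D x g)
    <= nrm (w - z) / N%:R * (N%:R * nrm (w - z) + rho) * (L * M).
  rewrite ler_pM ?nrm_ge0//; last first.
    by apply: (le_trans (DL _ Bx)); rewrite ler_wpM2l.
  rewrite nrmM nrm_step ler_wpM2l ?mulr_ge0//.
  apply: (le_trans (nrmB _ _)); rewrite lerD// nrmM nrm_nat ler_wpM2r//.
  by rewrite ler_nat ltnW.
have B4 : nrm (j.+1%:R * (w - z)) *
    nrm (G (euler z N j.+1) - g - (z / N%:R) *: D x g)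
    <= N%:R * nrm (w - z) * (K * (rho / N%:R * M) ^+ 2).
  rewrite ler_pM ?nrm_ge0//; first by rewrite nrmM nrm_nat ler_wpM2r// ler_nat.
  apply: (le_trans R2).
  rewrite ler_wpM2l// lerXn2r ?nnegrE ?nrm_ge0//.
    by rewrite mulr_ge0// mulr_ge0// ltW.
  by rewrite nrmZ nrm_step ler_pM ?mulr_ge0// ler_wpM2r.
have -> : k = rho * (K * (2 * (M * nrm (w - z))) ^+ 2)
   + nrm (w - z) / N%:R * (N%:R * nrm (w - z) + rho) * (L * M)
   + N%:R * nrm (w - z) * (K * (rho / N%:R * M) ^+ 2).
  by rewrite /k; field; rewrite gt_eqF.
move: B1 B2 B3 B4; rewrite !nrmM; lra.
Qed.

Hypothesis E_complete : geometrically_complete E.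

Lemma holomorphic_flow : exists U : C -> E,
  [/\ U 0 = X0, forall z, nrm z <= rho -> nrm (U z - X0) <= rho * M
    & exists c, forall z w, nrm z <= rho -> nrm w <= rho ->
        nrm (U w - U z - (w - z) *: G (U z)) <= c * nrm (w - z) ^+ 2].
Proof.
pose eu i z := euler z (2 ^ i) (2 ^ i).
have /choice[U UP] : forall z, exists l, nrm z <= rho ->
    exists d, forall i, nrm (eu i z - l) <= d / 2 ^+ i.
  move=> z; have [zr|zr] := leP (nrm z) rho; last first.
    by exists 0.
  have [|l [d ld]] := E_complete (u := fun i => eu i z) (c := 2 * (rho * (L * (rho * M)))).
    move=> i; rewrite /eu expnS -natrX; apply: euler_double => //.
    by rewrite expn_gt0.
  by exists l => _; exists d.
have Ub z : nrm z <= rho -> nrm (U z - X0) <= rho * M.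
  move=> zr; have [d dU] := UP z zr.
  apply: (@le_lim_pow2 _ _ d) => i.
  have -> : U z - X0 = (eu i z - X0) - (eu i z - U z) by module (Cx R).
  by apply: (le_trans (nrmB _ _)); rewrite lerD// euler_bound.
exists U; split=> //.
  have [|d dU] := UP 0; first by rewrite nrm0 ltW.
  have eu0 i : eu i 0 = X0.
    rewrite /eu; elim: {2}(2 ^ i)%N => // j; rewrite eulerS => ->.
    by rewrite mul0r scale0r addr0.
  apply/eqP; rewrite eq_sym -subr_eq0; apply/eqP/nrm_le0.
  by apply: (@le_lim_pow2 _ _ d) => i; rewrite add0r -(eu0 i).
set c1 := 4 * rho * K * M ^+ 2 + L * M.
set c2 := rho * L * M + K * (rho * M) ^+ 2.
exists (2 * c1) => z w zr wr.
have [d dU] := UP z zr; have [e eU] := UP w wr.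
apply: (@le_lim_pow2 _ _ (2 * c2 * nrm (w - z) + d + e + nrm (w - z) * (L * d))) => i.
have near_eu : near0 (eu i z) by apply: euler_box.
have near_U : near0 (U z) by apply: le_trans rhoM; apply: Ub.
have -> : U w - U z - (w - z) *: G (U z) =
  (eu i w - eu i z - (w - z) *: G (eu i z)) + (eu i z - U z) - (eu i w - U w)
   + (w - z) *: (G (eu i z) - G (U z)) by module (Cx R).
apply: (le_trans (nrmD _ _)); apply: (le_trans (lerD (nrmB _ _) (lexx _))).
apply: (le_trans (lerD (lerD (nrmD _ _) (lexx _)) (lexx _))).
have := @euler_diff z w (2 ^ i) zr wr.
rewrite expn_gt0 natrX -/c1 -/c2 => /(_ isT) B1.
have B2 := dU i; have B3 := eU i.
have B4 : nrm ((w - z) *: (G (eu i z) - G (U z))) <=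
   nrm (w - z) * (L * (d / 2 ^+ i)).
  rewrite nrmZ ler_wpM2l ?nrm_ge0//; apply: (le_trans (GL near_U near_eu)).
  by rewrite ler_wpM2l.
rewrite -/(eu i z) -/(eu i w) in B1.
move: B1 B2 B3 B4; lra.
Qed.

End Euler.

(** * Complex derivatives *)
Section Derivatives.
Variables (R : realType).
Local Notation C := (Cx R).

Lemma curve_deriv_unique (E : normedModType C) (c : R -> E) t d e :
  curve_deriv c t d -> curve_deriv c t e -> d = e.
Proof.
move=> cd ce; apply/eqP; rewrite -subr_eq0; apply/eqP/nrm_le0.
apply/ler_addgt0Pr => k k0; rewrite add0r.
have k20 : 0 < k / 2 by lra.
have [h1 h10 H1] := cd _ k20; have [h2 h20 H2] := ce _ k20.
pose u := Num.min h1 h2 / 2.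
have u0 : 0 < u by rewrite divr_gt0// lt_min h10.
have /andP[uh1 uh2] : (u < h1) && (u < h2).
  by rewrite -lt_min /u ltr_pdivrMr// ltr_pMr ?ltr1n// lt_min h10.
have tu : t + u - t = u by rewrite addrAC subrr add0r.
have := H1 (t + u); have := H2 (t + u); rewrite tu gtr0_norm// => /(_ uh2) B2 /(_ uh1) B1.
rewrite -(ler_pM2l u0); rewrite -[X in X * _](gtr0_norm u0) -nrm_ofR -nrmZ.
have -> : ofR u *: (d - e) = (c (t + u) - c t - ofR u *: e) -
  (c (t + u) - c t - ofR u *: d) by module (Cx R).
apply: (le_trans (nrmB _ _)); lra.
Qed.

Lemma curve_deriv_shift (V W : normedModType C) (f : V -> W) p v s d :
  curve_deriv (fun t => f (p + ofR s *: v + ofR t *: v)) 0 d ->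
  curve_deriv (fun t => f (p + ofR t *: v)) s d.
Proof.
move=> fd e /fd[h h0 H]; exists h => // t ts; have := H (t - s).
rewrite !subr0 => /(_ ts); rewrite scale0r addr0.
have -> : p + ofR s *: v + ofR (t - s) *: v = p + ofR t *: v.
  by rewrite ofRB; module (Cx R).
by [].
Qed.

Lemma real_quotientP (V W : normedModType C) (f : V -> W) p v d :
  (real_quotient f p v t @[t --> 0^'] --> d) <->
  curve_deriv (fun t => f (p + ofR t *: v)) 0 d.
Proof.
have E t : t != 0 ->
    nrm (f (p + ofR t *: v) - f (p + ofR 0 *: v) - ofR (t - 0) *: d) =
    `|t| * nrm (d - real_quotient f p v t).
  move=> t0; rewrite /real_quotient -nrm_ofR -nrmZ nrmBC subr0 scale0r addr0.
  have tC : ofR t != 0 by rewrite ofR_eq0.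
  by congr nrm; rewrite ofRV; module (Cx R).
split=> [/cvgrPdist_le H e e0|H].
  have /H : (0 : C) < ofR e by rewrite -ofR0 ofR_lt.
  move=> /nbhs_ballP[h /= h0 hH]; exists h => // t; rewrite {1 3}subr0 => th.
  have [->|t0] := eqVneq t 0.
    by rewrite /= !subr0 ofR0 !scale0r subr0 subrr nrm0 normr0 mulr0.
  rewrite E// mulrC ler_wpM2r// -nrm_le; apply: hH => //.
  by rewrite /ball/= sub0r normrN.
apply/cvgrPdist_le => e e0.
have er : e = ofR (complex.Re e) by rewrite /ofR (RRe_real (gtr0_real e0)).
have := e0; rewrite er -ofR0 ofR_lt => {}/H[h h0 hH].
apply/nbhs_ballP; exists h => // t; rewrite /ball/= sub0r normrN => th t0.
rewrite nrm_le; have := hH t; rewrite {1 3}subr0 => /(_ th).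
by rewrite E// mulrC ler_pM2r// normr_gt0.
Qed.

Lemma differentiable_nrm (V W : normedModType C) (f : V -> W) p :
  differentiable f p -> forall e, 0 < e -> exists2 h, 0 < h & forall v,
    nrm v < h -> nrm (f (p + v) - f p - 'd f p v) <= e * nrm v.
Proof.
move=> /diff_locally /eqaddoP H e e0.
have e0' : (0 : C) < ofR e by rewrite -ofR0 ofR_lt.
have /nbhs_nrm[h h0 hH] := H _ e0'.
exists h => // v vh; have := hH v; rewrite subr0 => /(_ vh).
rewrite !nrmE -ofRM ofR_le; apply: le_trans.
rewrite le_eqVlt; apply/orP; left; apply/eqP; congr nrm.
by rewrite [p + v]addrC -addrA -opprD.
Qed.

Definition complex_deriv (W : normedModType C) (f : C -> W) z d : Prop :=
  forall e, 0 < e -> exists2 h, 0 < h & forall w, nrm (w - z) < h ->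
    nrm (f w - f z - (w - z) *: d) <= e * nrm (w - z).

Lemma differentiable_complex_deriv (W : normedModType C) (f : C -> W) z :
  differentiable f z -> complex_deriv f z ('d f z 1).
Proof.
move=> fz e e0; have [h h0 H] := differentiable_nrm fz e0.
exists h => // w /H; rewrite [z + _]addrC subrK.
by rewrite -{1}[w - z]mulr1 -[_ * 1]/(_ *: _) linearZ.
Qed.

Lemma complex_deriv_differentiable (W : normedModType C) (f : C -> W) z d :
  complex_deriv f z d -> differentiable f z.
Proof.
move=> fd; apply/derivable1_diffP/cvg_ex; exists d.
apply/cvgrPdist_le => e e0.
have er : e = ofR (complex.Re e) by rewrite /ofR (RRe_real (gtr0_real e0)).
have := e0; rewrite er -ofR0 ofR_lt => {}/fd[h h0 hH].
rewrite near_withinE; apply/nbhs_nrm; exists h => // t; rewrite subr0 => th t0.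
rewrite nrm_le; have := hH (t + z); rewrite addrK => /(_ th) B.
have nt : 0 < nrm t.
  by rewrite lt_def nrm_ge0 andbT; apply: contra_neq t0 => t0; apply/nrm_le0; rewrite t0.
rewrite nrmBC -(ler_pM2l nt) -nrmZ [_ * complex.Re e]mulrC.
apply: le_trans B; rewrite le_eqVlt; apply/orP; left; apply/eqP; congr nrm.
rewrite /= -[t *: 1]/(t * 1) mulr1.
by rewrite scalerBr scalerA mulfV// scale1r.
Qed.

Lemma complex_deriv_curve (W : normedModType C) (f : C -> W) z v d s :
  complex_deriv f (z + ofR s * v) d ->
  curve_deriv (fun t => f (z + ofR t * v)) s (v *: d).
Proof.
move=> fd e e0.
have v0 : 0 < nrm v + 1 by have := nrm_ge0 v; lra.
have [h h0 H] := fd _ (divr_gt0 e0 v0).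
have E t : z + ofR t * v - (z + ofR s * v) = ofR (t - s) * v.
  by rewrite ofRB; ring.
exists (h / (nrm v + 1)); first exact: divr_gt0.
move=> t; rewrite ltr_pdivlMr// => ts.
have := H (z + ofR t * v); rewrite E nrmM nrm_ofR scalerA => H'.
apply: (le_trans (H' _)).
  by apply: le_lt_trans ts; rewrite ler_wpM2l// lerDl.
rewrite mulrCA mulrC ler_wpM2r// mulrAC ler_pdivrMr// ler_wpM2l ?ltW//.
by rewrite ltrDl.
Qed.

Lemma real_derive_complex_deriv (W : normedModType C) (f : C -> W) z v d :
  complex_deriv f z d -> real_derive v f z = v *: d.
Proof.
move=> fd; apply: cvg_lim => //; apply/real_quotientP.
by apply: complex_deriv_curve; rewrite mul0r addr0.
Qed.

(** For a holomorphic function the derivative along ['i] is ['i] times the one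
    along 1, so that [dz] returns the complex derivative. *)
Lemma dz_complex_deriv n (f : C -> 'rV[C]_n) z d :
  complex_deriv f z d -> dz f z = d.
Proof.
move=> fd; rewrite /dz !(real_derive_complex_deriv _ fd) scalerA.
rewrite -expr2 sqrCi.
have -> : (1 : C) *: d - -1 *: d = 2 *: d by module (Cx R).
by rewrite scalerA mulVf ?scale1r// pnatr_eq0.
Qed.

Lemma near_complex_deriv (W : normedModType C) (f g : C -> W) z d :
  (\forall w \near z, f w = g w) -> complex_deriv f z d -> complex_deriv g z d.
Proof.
move=> fg fd e /fd[h h0 H].
have fgz := nbhs_singleton fg.
have [k k0 K] := (nbhs_nrm _ _).1 fg.
exists (Num.min h k) => [|w]; first by rewrite lt_min h0.
by rewrite lt_min => /andP[/H + /K <-]; rewrite -fgz.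
Qed.

End Derivatives.

(** * Taylor estimates for maps of class C^2 *)
Section Taylor.
Variables (R : realType).
Local Notation C := (Cx R).

Lemma differentiable_curve (V W : normedModType C) (f : V -> W) p v :
  differentiable f p -> curve_deriv (fun t => f (p + ofR t *: v)) 0 ('d f p v).
Proof.
move=> fp e e0; have v0 : 0 < nrm v + 1 by have := nrm_ge0 v; lra.
have [h h0 H] := differentiable_nrm fp (divr_gt0 e0 v0).
exists (h / (nrm v + 1)); first exact: divr_gt0.
move=> t; rewrite subr0 ltr_pdivlMr// => ts.
rewrite ofR0 scale0r addr0.
have := H (ofR t *: v); rewrite nrmZ nrm_ofR linearZ => H'.
apply: (le_trans (H' _)).
  by apply: le_lt_trans ts; rewrite ler_wpM2l// lerDl.
rewrite mulrCA mulrC ler_wpM2r// mulrAC ler_pdivrMr// ler_wpM2l ?ltW//.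
by rewrite ltrDl.
Qed.

Lemma curve_deriv_scale (W : normedModType C) (c : R -> W) t s d :
  curve_deriv c (t * s) d ->
  curve_deriv (fun s => c (t * s)) s (ofR t *: d).
Proof.
move=> cd e e0; have t0 : 0 < `|t| + 1 by have := normr_ge0 t; lra.
have [h h0 H] := cd _ (divr_gt0 e0 t0).
exists (h / (`|t| + 1)); first exact: divr_gt0.
move=> u; rewrite ltr_pdivlMr// => us.
have := H (t * u); rewrite -mulrBr normrM => H'.
rewrite scalerA -ofRM [(u - s) * t]mulrC; apply: (le_trans (H' _)).
  by apply: le_lt_trans us; rewrite mulrC ler_wpM2l// lerDl.
rewrite mulrA ler_wpM2r// mulrAC ler_pdivrMr// ler_wpM2l ?ltW//.
by rewrite ltrDl.
Qed.

Lemma class_C_within (V W : normedModType C) k (A : set V) (f : V -> W) :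
  class_C k A f -> {within A, continuous f}.
Proof. by case: k => [|k] []. Qed.

Section Local.
Variables (V W : normedModType C) (A : set V) (x0 : V).
Hypothesis A_x0 : A° x0.

Lemma within_bounded (g : V -> W) : {within A, continuous g} ->
  exists2 r, 0 < r & exists2 M, 0 <= M & forall p, nrm (p - x0) <= r ->
    A° p /\ nrm (g p) <= M.
Proof.
move=> /subspace_continuousP/(_ x0 (interior_subset A_x0))/cvgrPdist_le/(_ 1 ltr01).
rewrite near_withinE => gx0.
have Ax0 : \forall p \near x0, A p := A_x0.
have AAx0 : \forall p \near x0, A° p.
  by apply: open_nbhs_nbhs; split => //; exact: open_interior.
have : \forall p \near x0, A° p /\ `|g x0 - g p| <= 1.
  move: gx0 Ax0 AAx0; apply: filterS3 => p gp Ap AAp.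
  by split => //; exact: gp.
move=> /nbhs_nrm[r r0 H]; exists (r / 2); first by lra.
exists (nrm (g x0) + 1) => [|p pr]; first by have := nrm_ge0 (g x0); lra.
have /H[Ap gp] : nrm (p - x0) < r by lra.
split=> //; have -> : g p = g x0 - (g x0 - g p) by rewrite opprB addrC subrK.
by apply: (le_trans (nrmB _ _)); rewrite lerD2l -nrm_le.
Qed.

(** [class_C] bounds the derivative along each fixed direction only; nothing is
    known a priori on its dependence on the direction.  Lipschitz estimates are
    therefore obtained one direction at a time and then summed over a basis. *)
Definition dir_lipschitz (g : V -> W) (v : V) : Prop :=
  exists2 r, 0 < r & exists2 K, 0 <= K & forall p t, nrm (p - x0) <= r ->
    `|t| <= r -> nrm (g (p + ofR t *: v) - g p) <= K * `|t|.

Lemma class_C_dir_lipschitz k (g : V -> W) v :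
  class_C k.+1 A g -> dir_lipschitz g v.
Proof.
move=> [_ /(_ v)[h hk gh]].
have [r r0 [M M0 hM]] := within_bounded (class_C_within hk).
have v0 : 0 < 1 + nrm v by have := nrm_ge0 v; lra.
set d := r / (1 + nrm v); have dr : d * (1 + nrm v) = r by rewrite divfK ?gt_eqF.
exists d; first exact: divr_gt0.
exists M => // p t pr tr.
have H s : 0 <= s <= 1 -> nrm (p + ofR (t * s) *: v - x0) <= r.
  move=> /andP[s0 s1]; rewrite addrAC; apply: (le_trans (nrmD _ _)).
  rewrite nrmZ nrm_ofR normrM (ger0_norm s0) -dr mulrDr mulr1 lerD//.
  by rewrite ler_wpM2r ?nrm_ge0//; apply: le_trans tr; rewrite ler_piMr.
have := @mean_value _ _ (fun s => g (p + ofR (t * s) *: v)) (M * `|t|) (mulr_ge0 M0 (normr_ge0 t)).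
rewrite mulr0 mulr1 ofR0 scale0r addr0; apply => s /H/hM[Ap hp].
exists (ofR t *: h (p + ofR (t * s) *: v)); last first.
  by rewrite nrmZ nrm_ofR mulrC ler_wpM2r.
apply: (@curve_deriv_scale _ (fun s => g (p + ofR s *: v))).
by apply: curve_deriv_shift; apply/real_quotientP; apply: gh.
Qed.

(** Moving from [p] one basis direction after the other. *)
Lemma dir_lipschitz_sum (g : V -> W) (I : eqType) (b : I -> V) (s : seq I) :
  (forall i, dir_lipschitz g (b i)) ->
  exists2 r, 0 < r & exists2 K, 0 <= K & forall p (t : I -> R) u,
    nrm (p - x0) <= r -> u <= r -> (forall i, `|t i| <= u) ->
    nrm (g (p + \sum_(i <- s) ofR (t i) *: b i) - g p) <= K * u.
Proof.
move=> gb; elim: s => [|i s [r r0 [K K0 H]]].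
  exists 1 => //; exists 0 => // p t u _ _ _.
  by rewrite big_nil addr0 subrr nrm0 mul0r.
have [r' r'0 [K' K'0 H']] := gb i.
have v0 : 0 < 1 + nrm (b i) by have := nrm_ge0 (b i); lra.
pose d := Num.min r' (r / (1 + nrm (b i))).
have d0 : 0 < d by rewrite lt_min r'0 divr_gt0.
have dr' : d <= r' by rewrite ge_min lexx.
have dr : d * (1 + nrm (b i)) <= r by rewrite -ler_pdivlMr// ge_min lexx orbT.
exists d => //; exists (K' + K) => [|p t u pd ud tu]; first exact: addr_ge0.
rewrite big_cons addrA.
set p' := p + ofR (t i) *: b i; set q := p' + _.
have -> : g q - g p = (g p' - g p) + (g q - g p') by module (Cx R).
apply: (le_trans (nrmD _ _)); rewrite mulrDl lerD//.
  apply: (le_trans (H' _ _ (le_trans pd dr') _)); last by rewrite ler_wpM2l.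
  exact: le_trans (tu i) (le_trans ud dr').
have b0 := nrm_ge0 (b i).
apply: H => //.
  rewrite /p' addrAC; apply: (le_trans (nrmD _ _)); rewrite nrmZ nrm_ofR.
  have : `|t i| * nrm (b i) <= d * nrm (b i).
    by rewrite ler_wpM2r//; apply: le_trans (tu i) ud.
  lra.
by apply: (le_trans ud); apply: le_trans dr; rewrite ler_peMr ?(ltW d0)// lerDl.
Qed.

Definition coordinates (I : finType) (b : I -> V) (x : V -> I -> C) : Prop :=
  forall v, v = \sum_i x v i *: b i /\ forall i, nrm (x v i) <= nrm v.

Variables (I : finType) (b : I -> V) (x : V -> I -> C).
Hypothesis bx : coordinates b x.

(** A path along the real axes, which are the [b i] and the ['i *: b i], joins
    [p] to [q]; both coordinates of each complex increment are at most
    [nrm (q - p)]. *)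
Lemma class_C_lipschitz k (g : V -> W) : class_C k.+1 A g ->
  exists2 r, 0 < r & exists2 K, 0 <= K & forall p q,
    nrm (p - x0) <= r -> nrm (q - x0) <= r -> nrm (g q - g p) <= K * nrm (q - p).
Proof.
move=> gC.
pose b' (i : I * bool) := if i.2 then 'i *: b i.1 else b i.1.
have [|r r0 [K K0 H]] := @dir_lipschitz_sum g _ b' (index_enum (I * bool)%type).
  by move=> i; apply: class_C_dir_lipschitz gC.
exists (r / 2); first by lra.
exists K => // p q pr qr.
pose t (i : I * bool) :=
  if i.2 then complex.Im (x (q - p) i.1) else complex.Re (x (q - p) i.1).
have qp : q - p = \sum_i ofR (t i) *: b' i.
  rewrite (bx (q - p)).1 -(pair_big xpredT xpredT (fun i j => ofR (t (i, j)) *: b' (i, j))) /=.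
  apply: eq_bigr => i _; rewrite big_bool /b' /t /=.
  by rewrite {1}[x (q - p) i]ReImE; module (Cx R).
have -> : g q = g (p + \sum_i ofR (t i) *: b' i) by rewrite -qp addrC subrK.
apply: H; first by lra.
  have -> : q - p = (q - x0) - (p - x0) by module (Cx R).
  by apply: (le_trans (nrmB _ _)); lra.
move=> [i []]; rewrite /t /=; apply: le_trans ((bx (q - p)).2 i).
  exact: nrm_Im.
exact: nrm_Re.
Qed.

Lemma finite_uniform (P : I -> R -> R -> Prop) :
  (forall i r r' K K', r' <= r -> K <= K' -> P i r K -> P i r' K') ->
  (forall i, exists2 r, 0 < r & exists2 K, 0 <= K & P i r K) ->
  exists2 r, 0 < r & exists2 K, 0 <= K & forall i, P i r K.
Proof.
move=> Pm PI.
suff [r r0 [K K0 H]] : exists2 r, 0 < r & exists2 K, 0 <= K &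
    forall i, i \in enum I -> P i r K.
  by exists r => //; exists K => // i; apply: H; rewrite mem_enum.
elim: (enum I) => [|i s [r r0 [K K0 H]]]; first by exists 1 => //; exists 0.
have [r' r'0 [K' K'0 H']] := PI i.
exists (Num.min r r'); first by rewrite lt_min r0.
exists (Num.max K K'); first by rewrite le_max K0.
move=> j; rewrite inE => /predU1P[->|/H Pj].
  by apply: Pm H'; rewrite ?ge_min ?le_max lexx orbT.
by apply: Pm Pj; rewrite ?ge_min ?le_max lexx.
Qed.

Lemma ball_segment (p q : V) r s : 0 <= s <= 1 -> nrm (p - x0) <= r ->
  nrm (q - x0) <= r -> nrm (p + ofR s *: (q - p) - x0) <= r.
Proof.
move=> /andP[s0 s1] pr qr.
have -> : p + ofR s *: (q - p) - x0 = ofR (1 - s) *: (p - x0) + ofR s *: (q - x0).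
  by rewrite ofRB ofR1; module (Cx R).
apply: (le_trans (nrmD _ _)); rewrite !nrmZ !nrm_ofR !ger0_norm ?subr_ge0//.
have := ler_wpM2l s0 qr; have : (1 - s) * nrm (p - x0) <= (1 - s) * r.
  by rewrite ler_wpM2l ?subr_ge0.
lra.
Qed.

(** On a complex basis the differential of [f] has the components given by
    [class_C], which are themselves Lipschitz since [f] is of class C^2; complex
    linearity of the differential then makes it bounded and Lipschitz, and the
    mean value inequality on the segment from [p] to [q] yields the rest. *)
Lemma C2_taylor k (f : V -> W) : class_C k.+2 A f ->
  (forall p, A° p -> differentiable f p) ->
  exists2 r, 0 < r & exists2 K, 0 <= K & forall p, nrm (p - x0) <= r ->
    [/\ A° p, nrm (f p) <= K, forall v, nrm ('d f p v) <= K * nrm v,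
      forall q, nrm (q - x0) <= r -> nrm (f q - f p) <= K * nrm (q - p)
    & forall q, nrm (q - x0) <= r ->
        nrm (f q - f p - 'd f p (q - p)) <= K * nrm (q - p) ^+ 2].
Proof.
move=> [fc fd] fdiff.
have [r1 r10 [M M0 fM]] := within_bounded fc.
have /choice[g gP] : forall i, exists g, class_C k.+1 A g /\
    forall p, A° p -> 'd f p (b i) = g p.
  move=> i; have [g gC fg] := fd (b i); exists g; split=> // p Ap.
  apply: (@curve_deriv_unique _ _ (fun t => f (p + ofR t *: b i)) 0).
    by apply: differentiable_curve; apply: fdiff.
  by apply/real_quotientP; apply: fg.
have [||r2 r20 [L L0 gL]] := @finite_uniform (fun i r K =>
    (forall p, nrm (p - x0) <= r -> nrm (g i p) <= K) /\
    (forall p q, nrm (p - x0) <= r -> nrm (q - x0) <= r ->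
       nrm (g i q - g i p) <= K * nrm (q - p))).
- move=> i r r' K K' rr KK [H1 H2]; split=> [p pr|p q pr qr].
    by apply: le_trans KK; apply: H1; apply: le_trans rr.
  apply: (@le_trans _ _ (K * nrm (q - p))); first by apply: H2; apply: le_trans rr.
  by rewrite ler_wpM2r ?nrm_ge0.
- move=> i; have [gC _] := gP i.
  have [s s0 [K K0 H]] := within_bounded (class_C_within gC).
  have [s' s'0 [K' K'0 H']] := class_C_lipschitz gC.
  exists (Num.min s s'); first by rewrite lt_min s0.
  exists (Num.max K K'); first by rewrite le_max K0.
  split=> [p|p q]; rewrite !le_min => /andP[ps ps'].
    by apply: (le_trans (H p ps).2); rewrite le_max lexx.
  move=> /andP[qs qs']; apply: (le_trans (H' _ _ ps' qs')).
  by rewrite ler_wpM2r ?nrm_ge0// le_max lexx orbT.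
pose r := Num.min r1 r2.
have r0 : 0 < r by rewrite lt_min r10.
have rr1 p : nrm (p - x0) <= r -> nrm (p - x0) <= r1.
  by move=> /le_trans; apply; rewrite ge_min lexx.
have rr2 p : nrm (p - x0) <= r -> nrm (p - x0) <= r2.
  by move=> /le_trans; apply; rewrite ge_min lexx orbT.
have dE p v : nrm (p - x0) <= r -> 'd f p v = \sum_i x v i *: g i p.
  move=> /rr1/fM[Ap _]; rewrite {1}(bx v).1 linear_sum; apply: eq_bigr => i _.
  by rewrite linearZ (gP i).2.
pose N := #|I|%:R * L.
have N0 : 0 <= N by rewrite mulr_ge0.
have sumL v (h : I -> W) c : 0 <= c -> (forall i, nrm (h i) <= L * c) ->
    nrm (\sum_i x v i *: h i) <= N * nrm v * c.
  move=> c0 hL.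
  have -> : N * nrm v * c = \sum_(i : I) nrm v * (L * c).
    by rewrite sumr_const /N -[RHS]mulr_natl; ring.
  elim/big_ind2 : _ => [|y1 y2 z1 z2 H1 H2|i _]; first by rewrite nrm0.
    by apply: (le_trans (nrmD _ _)); apply: lerD.
  rewrite nrmZ ler_pM ?nrm_ge0//.
  exact: (bx v).2.
have dL p v : nrm (p - x0) <= r -> nrm ('d f p v) <= N * nrm v.
  move=> pr; rewrite dE// -[leRHS]mulr1; apply: sumL => // i.
  by rewrite mulr1; apply: (gL i).1; apply: rr2.
have dLip p q v : nrm (p - x0) <= r -> nrm (q - x0) <= r ->
    nrm ('d f q v - 'd f p v) <= N * nrm v * nrm (q - p).
  move=> pr qr; rewrite !dE// -sumrB.
  rewrite (eq_bigr (fun i => x v i *: (g i q - g i p))); last first.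
    by move=> i _; rewrite scalerBr.
  by apply: sumL; rewrite ?nrm_ge0// => i; apply: (gL i).2; apply: rr2.
have line p q s : 0 <= s <= 1 -> nrm (p - x0) <= r -> nrm (q - x0) <= r ->
    curve_deriv (fun s => f (p + ofR s *: (q - p))) s
      ('d f (p + ofR s *: (q - p)) (q - p)).
  move=> s01 pr qr; apply: curve_deriv_shift; apply: differentiable_curve.
  by apply: fdiff; apply: (fM _ _).1; apply: rr1; apply: ball_segment.
exists r => //; exists (M + N) => [|p pr]; first exact: addr_ge0.
have dK v : nrm ('d f p v) <= (M + N) * nrm v.
  by apply: (le_trans (dL _ _ pr)); rewrite ler_wpM2r ?nrm_ge0// lerDr.
split=> //.
- exact: (fM _ (rr1 _ pr)).1.
- by apply: (le_trans (fM _ (rr1 _ pr)).2); rewrite lerDl.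
- move=> q qr.
  have := @mean_value _ _ (fun s => f (p + ofR s *: (q - p))) ((M + N) * nrm (q - p)).
  rewrite ofR1 ofR0 scale1r scale0r addr0 [p + _]addrC subrK; apply.
    by rewrite mulr_ge0 ?nrm_ge0// addr_ge0.
  move=> s s01; exists ('d f (p + ofR s *: (q - p)) (q - p)); first exact: line.
  apply: (le_trans (dL _ _ (ball_segment s01 pr qr))).
  by rewrite ler_wpM2r ?nrm_ge0// lerDr.
- move=> q qr.
  have := @mean_value _ _ (fun s => f (p + ofR s *: (q - p)) - ofR s *: 'd f p (q - p))
     ((M + N) * nrm (q - p) ^+ 2).
  rewrite ofR1 ofR0 !scale1r !scale0r addr0 subr0 [p + _]addrC subrK addrAC; apply.
    by rewrite mulr_ge0 ?exprn_ge0 ?nrm_ge0// addr_ge0.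
  move=> s s01; exists ('d f (p + ofR s *: (q - p)) (q - p) - 'd f p (q - p)).
    apply: curve_derivB; first exact: line.
    move=> e e0; exists 1 => // u _.
    by rewrite -scalerBl -ofRB subrr nrm0 mulr_ge0// ltW.
  apply: (le_trans (dLip _ _ _ pr (ball_segment s01 pr qr))).
  rewrite [p + _]addrC addrK nrmZ nrm_ofR.
  have /andP[s0 s1] := s01; rewrite (ger0_norm s0).
  rewrite -mulrA; apply: ler_pM => //.
  - by rewrite !mulr_ge0 ?nrm_ge0.
  - by rewrite lerDr.
  - by rewrite mulrCA expr2 ler_piMl// mulr_ge0 ?nrm_ge0.
Qed.

End Local.
End Taylor.

(** * The space of times and jets *)
Section Norms.
Variables (R : realType).
Local Notation C := (Cx R).

Lemma nrm_pair (V W : normedModType C) (p : V * W) :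
  nrm p = Num.max (nrm p.1) (nrm p.2).
Proof.
apply/eqP; rewrite -(inj_eq (@complexI R)); apply/eqP; rewrite -!/(ofR _) -nrmE.
by rewrite ProdNormedZmodule.prod_normE !nrmE !maxEle ofR_le; case: ifP.
Qed.

Lemma nrm_pair_le (V W : normedModType C) (p : V * W) e :
  (nrm p <= e) = (nrm p.1 <= e) && (nrm p.2 <= e).
Proof. by rewrite nrm_pair ge_max. Qed.

Lemma nrm_fst (V W : normedModType C) (p : V * W) : nrm p.1 <= nrm p.
Proof. by rewrite nrm_pair le_max lexx. Qed.
Lemma nrm_snd (V W : normedModType C) (p : V * W) : nrm p.2 <= nrm p.
Proof. by rewrite nrm_pair le_max lexx orbT. Qed.

Variables (m n : nat).
Implicit Type A : 'M[C]_(m, n).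

Lemma nrm_entry A i j : nrm (A i j) <= nrm A.
Proof.
rewrite -ofR_le -!nrmE [X in _ <= X]mx_normE -[leLHS]nngE num_le.
exact: (le_bigmax _ (fun i : 'I_m * 'I_n => `|A i.1 i.2|%:nng) (i, j)).
Qed.

Lemma nrm_mx_le A e : 0 <= e -> (forall i j, nrm (A i j) <= e) -> nrm A <= e.
Proof.
move=> e0 Ae; have [->//|A0] := eqVneq (nrm A) 0.
have : mx_norm A != 0 by rewrite -[mx_norm A]/(`|A|) nrmE ofR_eq0.
move=> /mx_norm_neq0[[i j] /=]; rewrite -[mx_norm A]/(`|A|) !nrmE.
by move=> /(@complexI R) ->.
Qed.

End Norms.

Lemma nrm_row (R : realType) m n (A : 'M[Cx R]_(m, n)) i : nrm (row i A) <= nrm A.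
Proof.
by apply: nrm_mx_le; rewrite ?nrm_ge0// => k j; rewrite mxE nrm_entry.
Qed.

Section Space.
Variables (R : realType) (m n : nat).
Local Notation C := (Cx R).

Lemma matrix_complete : geometrically_complete ('M[C]_(m, n)).
Proof.
move=> u c uc.
have /choice[l lP] : forall ij, exists l, exists d, forall k,
    nrm (u k ij.1 ij.2 - l) <= d / 2 ^+ k.
  move=> ij; apply: (@complex_complete _ (fun k => u k ij.1 ij.2) c) => k.
  by apply: le_trans (uc k); have := nrm_entry (u k.+1 - u k) ij.1 ij.2; rewrite !mxE.
have /choice[d dP] := lP.
have d0 ij : 0 <= d ij.
  by have := dP ij 0; rewrite expr0 divr1; apply: le_trans; exact: nrm_ge0.
exists (\matrix_(i, j) l (i, j)), (\sum_ij d ij) => k.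
have p0 : 0 <= (2 ^+ k)^-1 :> R by rewrite invr_ge0 exprn_ge0.
apply: nrm_mx_le => [|i j]; first by rewrite mulr_ge0// sumr_ge0.
rewrite !mxE; apply: (le_trans (dP (i, j) k)); rewrite ler_wpM2r//.
by rewrite (bigD1 (i, j))//= lerDl sumr_ge0.
Qed.

Lemma pair_complete (V W : normedModType C) : geometrically_complete V ->
  geometrically_complete W -> geometrically_complete (V * W)%type.
Proof.
move=> Vc Wc u c uc.
have [|l [d ld]] := Vc (fun k => (u k).1) c.
  by move=> k; apply: le_trans (uc k); apply: (nrm_fst (u k.+1 - u k)).
have [|l' [d' ld']] := Wc (fun k => (u k).2) c.
  by move=> k; apply: le_trans (uc k); apply: (nrm_snd (u k.+1 - u k)).
exists (l, l'), (Num.max d d') => k.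
have p0 : 0 <= (2 ^+ k)^-1 :> R by rewrite invr_ge0 exprn_ge0.
rewrite nrm_pair_le; apply/andP; split.
  by apply: (le_trans (ld k)); rewrite ler_wpM2r// le_max lexx.
by apply: (le_trans (ld' k)); rewrite ler_wpM2r// le_max lexx orbT.
Qed.

Let I : finType := (unit + 'I_m * 'I_n)%type.
Let b (i : I) : C * 'M[C]_(m, n) :=
  match i with inl _ => (1, 0) | inr ij => (0, delta_mx ij.1 ij.2) end.
Let x (v : C * 'M[C]_(m, n)) (i : I) : C :=
  match i with inl _ => v.1 | inr ij => v.2 ij.1 ij.2 end.

Lemma jet_coordinates : coordinates b x.
Proof.
move=> v; split; last first.
  case=> [_|[i j]] /=; first exact: nrm_fst.
  exact: le_trans (nrm_entry v.2 i j) (nrm_snd v).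
rewrite big_sumType /= big_const card_unit /= addr0.
have -> : \sum_(i : 'I_m * 'I_n) v.2 i.1 i.2 *: ((0, delta_mx i.1 i.2) : C * 'M[C]_(m, n))
   = (0, v.2).
  rewrite {2}[v.2]matrix_sum_delta pair_big /=.
  rewrite (big_morph (fun A : 'M[C]_(m, n) => (0 : C, A)) (id1 := 0) (op1 := +%R)) //.
    by apply: eq_bigr => i _; congr pair; rewrite scaler0.
  by move=> A B; congr pair; rewrite addr0.
rewrite [LHS]surjective_pairing; congr pair => /=.
  by rewrite addr0 -[_ *: _]/(_ * _) mulr1.
by rewrite scaler0 add0r.
Qed.
End Space.

(** * The first-order autonomous system *)
Section Contractions.
Variables (R : realType).
Local Notation C := (Cx R).

Lemma complex_deriv_linear (V W : normedModType C) (T : {linear V -> W})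
    (f : C -> V) z d : (forall v, nrm (T v) <= nrm v) ->
  complex_deriv f z d -> complex_deriv (T \o f) z (T d).
Proof.
move=> TV fd e /fd[h h0 H]; exists h => // w /H; apply: le_trans.
by rewrite /= -linearZ -!linearB.
Qed.

Lemma complex_deriv_pair (V W : normedModType C) (f : C -> V) (g : C -> W) z d e :
  complex_deriv f z d -> complex_deriv g z e ->
  complex_deriv (fun w => (f w, g w)) z (d, e).
Proof.
move=> fd ge k k0; have [h h0 H] := fd k k0; have [h' h'0 H'] := ge k k0.
exists (Num.min h h') => [|w]; first by rewrite lt_min h0.
by rewrite lt_min => /andP[/H wh /H' wh']; rewrite nrm_pair_le /= wh.
Qed.

Lemma complex_deriv_rows m n (f : C -> 'M[C]_(m, n)) z d :
  (forall i, complex_deriv (fun w => row i (f w)) z (row i d)) ->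
  complex_deriv f z d.
Proof.
move=> fd e e0.
have [|i|h h0 [_ _ H]] := @finite_uniform R 'I_m (fun i h _ => forall w, nrm (w - z) < h ->
    nrm (row i (f w) - row i (f z) - (w - z) *: row i d) <= e * nrm (w - z)).
- by move=> i h h' _ _ hh _ H w wh; apply: H; apply: lt_le_trans hh.
- by have [h h0 H] := fd i e e0; exists h => //; exists 0.
exists h => // w /H wh; apply: nrm_mx_le => [|i j].
  by rewrite mulr_ge0 ?nrm_ge0// ltW.
apply: le_trans (wh i).
by have := nrm_entry (row i (f w) - row i (f z) - (w - z) *: row i d) ord0 j; rewrite !mxE.
Qed.

End Contractions.

Section Companion.
Variables (R : realType) (m n : nat) (m_gt0 : (0 < m)%N).
Local Notation C := (Cx R).
Local Notation E := (C * 'M[C]_(m, n))%type.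

(** The right-hand side of the first-order system: rows move up by one and the
    last one is replaced by [v]. *)
Definition companion (A : 'M[C]_(m, n)) (v : 'rV[C]_n) : 'M[C]_(m, n) :=
  \matrix_(i, j) if insub i.+1 is Some i' then A i' j else v ord0 j.

Lemma nrm_companion A v e : nrm A <= e -> nrm v <= e -> nrm (companion A v) <= e.
Proof.
move=> Ae ve; apply: nrm_mx_le => [|i j]; first exact: le_trans (nrm_ge0 _) Ae.
rewrite mxE; case: (insub _) => [i'|]; first exact: le_trans (nrm_entry _ _ _) Ae.
exact: le_trans (nrm_entry _ _ _) ve.
Qed.

Lemma companionD A B u v :
  companion (A + B) (u + v) = companion A u + companion B v.
Proof. by apply/matrixP => i j; rewrite !mxE; case: (insub _) => [k|]; rewrite ?mxE. Qed.

Lemma companionZ c A u : companion (c *: A) (c *: u) = c *: companion A u.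
Proof. by apply/matrixP => i j; rewrite !mxE; case: (insub _) => [k|]; rewrite ?mxE. Qed.

Lemma companionB A B u v :
  companion (A - B) (u - v) = companion A u - companion B v.
Proof. by rewrite companionD -(scaleN1r B) -(scaleN1r v) companionZ scaleN1r. Qed.

Lemma row_companion A v (i : 'I_m) :
  row i (companion A v) = if insub i.+1 is Some i' then row i' A else v.
Proof.
apply/rowP => j; rewrite !mxE; case: (insub _) => [i'|]; first by rewrite mxE.
by rewrite ord1.
Qed.

Variables (H : E -> 'rV[C]_n) (x0 : E) (r K : R).
Hypotheses (r_gt0 : 0 < r) (K_ge0 : 0 <= K).
Hypothesis H_taylor : forall p, nrm (p - x0) <= r ->
  [/\ nrm (H p) <= K, forall v, nrm ('d H p v) <= K * nrm v,
      forall q, nrm (q - x0) <= r -> nrm (H q - H p) <= K * nrm (q - p)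
    & forall q, nrm (q - x0) <= r ->
        nrm (H q - H p - 'd H p (q - p)) <= K * nrm (q - p) ^+ 2].
Hypothesis x0_1 : x0.1 = 0.

Definition vfield (p : E) : E := (1, companion p.2 (H p)).
Definition vfield_diff (p v : E) : E := (0, companion v.2 ('d H p v)).

Let M := 1 + nrm x0 + r + K.
Let L := 1 + K.
Let M_gt0 : 0 < M.
Proof. by rewrite /M; move: (nrm_ge0 x0) r_gt0 K_ge0; lra. Qed.
Let L_gt0 : 0 < L.
Proof. by rewrite /L; move: K_ge0; lra. Qed.

Lemma vfield_bound p : nrm (p - x0) <= r -> nrm (vfield p) <= M.
Proof.
move=> pr; have [Hp _ _ _] := H_taylor pr.
rewrite nrm_pair_le /=; apply/andP; split.
  by rewrite (nrm_nat R 1) /M; move: (nrm_ge0 x0) r_gt0 K_ge0; lra.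
apply: nrm_companion; last first.
  by apply: (le_trans Hp); rewrite /M; move: (nrm_ge0 x0) r_gt0; lra.
apply: (le_trans (nrm_snd p)).
have -> : p = (p - x0) + x0 by rewrite subrK.
by apply: (le_trans (nrmD _ _)); rewrite /M; move: pr K_ge0; lra.
Qed.

Lemma vfield_lipschitz p q : nrm (p - x0) <= r -> nrm (q - x0) <= r ->
  nrm (vfield q - vfield p) <= L * nrm (q - p).
Proof.
move=> pr qr; have [_ _ Hq _] := H_taylor pr; have qp := nrm_ge0 (q - p).
rewrite nrm_pair_le /=; apply/andP; split.
  by rewrite subrr nrm0 mulr_ge0// ltW.
rewrite -companionB; apply: nrm_companion.
  by apply: (le_trans (nrm_snd (q - p))); rewrite ler_peMl// lerDl.
by apply: (le_trans (Hq _ qr)); rewrite ler_wpM2r// lerDr.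
Qed.

Lemma vfield_taylor p q : nrm (p - x0) <= r -> nrm (q - x0) <= r ->
  nrm (vfield q - vfield p - vfield_diff p (q - p)) <= K * nrm (q - p) ^+ 2.
Proof.
move=> pr qr; have [_ _ _ Hq] := H_taylor pr; have qp := nrm_ge0 (q - p).
have K0 : 0 <= K * nrm (q - p) ^+ 2 by rewrite mulr_ge0// exprn_ge0.
rewrite nrm_pair_le /=; apply/andP; split; first by rewrite !subrr ?subr0 nrm0.
rewrite -!companionB; apply: nrm_companion; last exact: Hq.
by rewrite subrr nrm0.
Qed.

Lemma vfield_diffD p u v : vfield_diff p (u + v) = vfield_diff p u + vfield_diff p v.
Proof. by rewrite /vfield_diff !linearD companionD; congr pair; rewrite addr0. Qed.

Lemma vfield_diffZ p c u : vfield_diff p (c *: u) = c *: vfield_diff p u.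
Proof. by rewrite /vfield_diff !linearZ companionZ; congr pair; rewrite scaler0. Qed.

Lemma vfield_diff_bound p u : nrm (p - x0) <= r ->
  nrm (vfield_diff p u) <= L * nrm u.
Proof.
move=> pr; have [_ Hp _ _] := H_taylor pr; have u0 := nrm_ge0 u.
rewrite nrm_pair_le /=; apply/andP; split; first by rewrite nrm0 mulr_ge0// ltW.
apply: nrm_companion.
  by apply: (le_trans (nrm_snd u)); rewrite ler_peMl// lerDl.
by apply: (le_trans (Hp u)); rewrite ler_wpM2r// lerDr.
Qed.

(** The first component of the flow has derivative 1 and vanishes at 0, which is
    why it is the time itself.  The trajectories stay in the ball of radius
    [r / 2], so as to leave room for the comparison with other solutions. *)
Lemma vfield_flow : exists2 rho, 0 < rho & rho * L <= 2^-1 /\ exists U : C -> E,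
  [/\ U 0 = x0, forall z, nrm z <= rho -> nrm (U z - x0) <= r / 2,
      forall z, nrm z < rho -> complex_deriv U z (vfield (U z))
    & forall z, nrm z < rho -> (U z).1 = z].
Proof.
pose rho := Num.min (r / 2 / M) (2^-1 / L).
have rho0 : 0 < rho by rewrite lt_min !divr_gt0.
have rM : rho * M <= r / 2 by rewrite -ler_pdivlMr// ge_min lexx.
have rL : rho * L <= 2^-1 by rewrite -ler_pdivlMr// ge_min lexx orbT.
have rM' : rho * M <= r by move: rM r_gt0; lra.
have [|U [U0 Ur [c Uc]]] := @holomorphic_flow R _ vfield vfield_diff x0 r M L K rho
  (ltW M_gt0) (ltW L_gt0) K_ge0 rho0 vfield_bound vfield_lipschitz vfield_taylor
  (fun p u v _ => vfield_diffD p u v) (fun p c u _ => vfield_diffZ p c u)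
  vfield_diff_bound rM' rL.
  apply: pair_complete; [exact: complex_complete | exact: matrix_complete].
exists rho => //; split=> //; exists U.
have Ud z : nrm z < rho -> complex_deriv U z (vfield (U z)).
  move=> zr e e0.
  have c0 : 0 < `|c| + 1 by move: (normr_ge0 c); lra.
  exists (Num.min (rho - nrm z) (e / (`|c| + 1))).
    by rewrite lt_min subr_gt0 zr divr_gt0.
  move=> w; rewrite lt_min => /andP[wz we].
  have wr : nrm w <= rho.
    have -> : w = (w - z) + z by rewrite subrK.
    by apply: (le_trans (nrmD _ _)); move: wz; lra.
  apply: (le_trans (Uc _ _ (ltW zr) wr)); rewrite expr2 mulrA.
  rewrite ler_wpM2r ?nrm_ge0//.
  move: we; rewrite ltr_pdivlMr// => we.
  move: we (ler_norm c) (nrm_ge0 (w - z)); nra.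
split=> // [z zr|z zr]; first exact: le_trans (Ur z zr) rM.
apply/eqP; rewrite -subr_eq0; apply/eqP/nrm_le0.
have := @mean_value R _ (fun t => (U (0 + ofR t * z)).1 - (0 + ofR t * z)) 0 (lexx _).
rewrite ofR1 mul1r ofR0 mul0r !add0r U0 x0_1 subrr subr0; apply => t /andP[t0 t1].
exists (z *: (1 : C) - z *: (1 : C)); last by rewrite subrr nrm0.
have tz : nrm (0 + ofR t * z) < rho.
  rewrite add0r nrmM nrm_ofR ger0_norm//; apply: le_lt_trans zr.
  by rewrite ler_piMl ?nrm_ge0.
apply: curve_derivB.
  apply: (@complex_deriv_curve R _ (fun w => (U w).1)).
  exact: (complex_deriv_linear (T := fst) (@nrm_fst _ _ _) (Ud _ tz)).
apply: (@complex_deriv_curve R _ id) => e e0; exists 1 => // w _.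
by rewrite -[_ *: 1]/(_ * 1) mulr1 subrr nrm0 mulr_ge0 ?nrm_ge0// ltW.
Qed.

End Companion.

(** * Solutions of the system of order m *)
Section Solutions.
Variables (R : realType) (m n : nat) (m_gt0 : (0 < m)%N).
Local Notation C := (Cx R).
Local Notation E := (C * 'M[C]_(m, n))%type.
Local Notation i0 := (Ordinal m_gt0).

Lemma disc_nrm (r : R) (z : C) : disc r z <-> nrm z <= r.
Proof. by rewrite /disc /= nrm_le. Qed.

Lemma Omega4_interior (Rstar R' : R) (a : 'M[C]_(m, n)) : 0 < Rstar ->
  (polydisc R')° (row i0 a) -> (Omega4 i0 Rstar R')° ((0, a) : E).
Proof.
move=> Rs0 /nbhs_nrm[e e0 He]; apply/nbhs_nrm.
exists (Num.min Rstar e) => [|q]; first by rewrite lt_min Rs0.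
rewrite lt_min => /andP[qR qe]; split.
  apply/disc_nrm/ltW; apply: le_lt_trans qR.
  by have := nrm_fst (q - (0, a)); rewrite /= subr0.
apply: He; apply: le_lt_trans qe; rewrite -linearB.
exact: le_trans (nrm_row _ _) (nrm_snd (q - (0, a))).
Qed.

Variable H : E -> 'rV[C]_n.

(** On the closed disc each [cderiv i f] with [i < m] is differentiable near
    every point, so [dz] computes its complex derivative; the equation provides
    the last row. *)
Lemma solution_flow Om a r f : holomorphic_solution Om H a r f ->
  forall z, nrm z <= r ->
  complex_deriv (fun w => (w, jet m f w)) z (vfield H (z, jet m f z)).
Proof.
move=> [fholo _ feq _] z zr; have /disc_nrm dz := zr.
apply: complex_deriv_pair.
  move=> e e0; exists 1 => // w _.
  by rewrite -[_ *: 1]/(_ * 1) mulr1 subrr nrm0 mulr_ge0 ?nrm_ge0// ltW.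
have fd (i : 'I_m) : complex_deriv (cderiv i f) z (cderiv i.+1 f z).
  have := differentiable_complex_deriv (nbhs_singleton (fholo i z dz)).
  by move=> fz; rewrite {2}/cderiv iterS -/(cderiv i f) (dz_complex_deriv fz).
apply: complex_deriv_rows => i; rewrite row_companion /=.
have rowj w (k : 'I_m) : row k (jet m f w) = cderiv k f w.
  by apply/rowP => j; rewrite !mxE.
have -> : (fun w => row i (jet m f w)) = cderiv i f.
  by apply/funext => w; rewrite rowj.
case: insubP => [i' _ ii|]; first by rewrite rowj ii; apply: fd.
rewrite -leqNgt => mi; rewrite -feq//.
have im : i.+1 = m by apply/eqP; rewrite eqn_leq mi ltn_ord.
by rewrite -[X in cderiv X f z]im; apply: fd.
Qed.

(** Conversely the rows of an integral curve are the successive derivatives of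
    its first row, because [dz] depends only on the germ of a function. *)
Lemma flow_solution (Om : set E) (U : C -> E) a r rho : 0 < r < rho ->
  U 0 = (0, a) -> (forall z, nrm z <= r -> Om (U z)) ->
  (forall z, nrm z < rho -> complex_deriv U z (vfield H (U z))) ->
  (forall z, nrm z < rho -> (U z).1 = z) ->
  holomorphic_solution Om H a r (fun z => row i0 (U z).2).
Proof.
move=> /andP[r0 rrho] U0 UOm Ud U1; set f := fun z => row i0 (U z).2.
have near_disc (z : C) : nrm z < rho -> \forall w \near z, nrm w < rho.
  move=> zr; apply/nbhs_nrm; exists (rho - nrm z); first by rewrite subr_gt0.
  move=> w wz; have -> : w = (w - z) + z by rewrite subrK.
  by apply: (le_lt_trans (nrmD _ _)); move: wz; lra.
have Fd (i : 'I_m) z : nrm z < rho -> complex_deriv (fun w => row i (U w).2) z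
    (row i (companion (U z).2 (H (U z)))).
  move=> zr; have Uz := complex_deriv_linear (T := snd) (@nrm_snd _ _ _) (Ud z zr).
  exact: (complex_deriv_linear (T := row i) (fun A => nrm_row A i) Uz).
have fF : forall (k : nat) (i : 'I_m), k = i -> forall z, nrm z < rho ->
    cderiv k f z = row i (U z).2.
  elim=> [|k IH] i ki z zr.
    by rewrite (_ : i = i0)//; apply: val_inj.
  have km : (k < m)%N by rewrite ltnW// ki.
  have kd := Fd (Ordinal km) z zr.
  rewrite /cderiv iterS -/(cderiv k f) (@dz_complex_deriv _ _ _ _ _ (near_complex_deriv _ kd)).
    rewrite row_companion /= ki insubT /= ?ltn_ord// => im.
    by congr (row _ _); apply: val_inj.
  by apply: (filterS _ (near_disc z zr)) => w wr; rewrite (IH (Ordinal km)) .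
have fd (i : 'I_m) z : nrm z < rho ->
    complex_deriv (cderiv i f) z (row i (companion (U z).2 (H (U z)))).
  move=> zr; apply: near_complex_deriv (Fd i z zr).
  by apply: (filterS _ (near_disc z zr)) => w wr; rewrite (fF i i).
have jetU z : nrm z < rho -> (z, jet m f z) = U z.
  move=> zr; rewrite [RHS]surjective_pairing U1//; congr pair.
  by apply/row_matrixP => i; rewrite -(fF i i)//; apply/rowP => j; rewrite !mxE.
have lt_rho z : disc r z -> nrm z < rho.
  by move=> /disc_nrm zr; apply: le_lt_trans rrho.
split.
- move=> i z /lt_rho zr; apply: (filterS _ (near_disc z zr)) => w wr.
  exact: complex_deriv_differentiable (fd i w wr).
- by move=> z zr; rewrite jetU ?lt_rho//; apply: UOm; apply/disc_nrm.
- move=> z /lt_rho zr; rewrite jetU//.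
  have mi : (m.-1 < m)%N by rewrite prednK.
  rewrite -{1}(prednK m_gt0) /cderiv iterS -/(cderiv m.-1 f).
  rewrite (dz_complex_deriv (fd (Ordinal mi) z zr)) row_companion /= prednK//.
  by rewrite insubF ?ltnn.
- by move=> i; rewrite (fF i i) ?nrm0 ?U0//; apply: lt_trans rrho.
Qed.

(** Only [U] is assumed to stay near [x0]: as long as [P] is within
    [e <= r / 2] of [U] it is in the ball where the field is Lipschitz, and the
    difference then has derivative at most [rho * L * e <= e / 2] along the ray
    to [z]. *)
Lemma integral_curve_unique (V : normedModType C) (G : V -> V) x0 (r L rho : R)
    (P U : C -> V) z :
  (forall p q, nrm (p - x0) <= r -> nrm (q - x0) <= r ->
     nrm (G q - G p) <= L * nrm (q - p)) ->
  0 < r -> 0 <= L -> rho * L <= 2^-1 -> nrm z <= rho -> P 0 = U 0 ->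
  (forall w, nrm w <= nrm z -> nrm (U w - x0) <= r / 2) ->
  (forall w, nrm w <= nrm z -> complex_deriv P w (G (P w))) ->
  (forall w, nrm w <= nrm z -> complex_deriv U w (G (U w))) ->
  P z = U z.
Proof.
move=> GL r0 L0 rL zrho PU Ur Pd Ud.
suff small e : 0 < e -> e <= r / 2 -> nrm (P z - U z) <= e.
  apply/eqP; rewrite -subr_eq0; apply/eqP/nrm_le0; rewrite leNgt.
  apply/negP => PUz; set d := nrm _ in PUz small.
  have := small (Num.min (d / 2) (r / 2)).
  rewrite lt_min !divr_gt0// ge_min lexx orbT => /(_ isT isT).
  by rewrite le_min => /andP[+ _]; move: PUz; lra.
move=> e0 er.
have := @mean_value_barrier R _ (fun t => P (0 + ofR t * z) - U (0 + ofR t * z)) (e / 2) e.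
rewrite ofR1 mul1r ofR0 mul0r !add0r PU subrr; apply => // [|t /andP[t0 t1]].
  by apply/andP; split; move: e0; lra.
set w := 0 + ofR t * z.
have wz : nrm w <= nrm z.
  by rewrite /w add0r nrmM nrm_ofR ger0_norm// ler_piMl ?nrm_ge0.
exists (z *: G (P w) - z *: G (U w)).
  by apply: curve_derivB; apply: complex_deriv_curve; [apply: Pd|apply: Ud].
move=> PUe; rewrite -scalerBr nrmZ.
have Uw := Ur w wz.
have Pw : nrm (P w - x0) <= r.
  have -> : P w - x0 = (P w - U w) + (U w - x0) by module (Cx R).
  by apply: (le_trans (nrmD _ _)); move: PUe Uw er; lra.
have Uw' : nrm (U w - x0) <= r by move: Uw r0; lra.
have rho0 : 0 <= rho := le_trans (nrm_ge0 _) zrho.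
apply: (@le_trans _ _ (rho * (L * e))).
  rewrite ler_pM ?nrm_ge0//; apply: (le_trans (GL _ _ Uw' Pw)).
  by rewrite ler_wpM2l.
by rewrite mulrA [e / 2]mulrC ler_wpM2r// ltW.
Qed.

End Solutions.

Theorem theorem1p11 (R : realType) (n m k : nat)
    (n_gt0 : (0 < n)%N) (m_gt0 : (0 < m)%N) (k_ge2 : (2 <= k)%N)
    (Rstar R' : R) (Rstar_gt0 : 0 < Rstar) (R'_gt0 : 0 < R')
    (H : Cx R * 'M[Cx R]_(m, n) -> 'rV[Cx R]_n)
    (H_Ck : class_C k (Omega4 (Ordinal m_gt0) Rstar R') H)
    (H_holo : holomorphic_on (Omega4 (Ordinal m_gt0) Rstar R')° H)
    (a : 'M[Cx R]_(m, n))
    (a0_int : (polydisc R')° (row (Ordinal m_gt0) a)) :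
  exists2 r0 : R, 0 < r0 &
    forall r : R, 0 < r <= r0 ->
      (exists f : Cx R -> 'rV[Cx R]_n,
         holomorphic_solution (Omega4 (Ordinal m_gt0) Rstar R') H a r f) /\
      (forall f g : Cx R -> 'rV[Cx R]_n,
         holomorphic_solution (Omega4 (Ordinal m_gt0) Rstar R') H a r f ->
         holomorphic_solution (Omega4 (Ordinal m_gt0) Rstar R') H a r g ->
         forall z, disc r z -> f z = g z).
Proof.
case: k k_ge2 H_Ck => [|[|k]]// _ H_Ck.
have x0_int := Omega4_interior Rstar_gt0 a0_int.
have H_diff p : (Omega4 (Ordinal m_gt0) Rstar R')° p -> differentiable H p.
  by move=> /H_holo/nbhs_singleton.
have [r1 r1_gt0 [K K_ge0 HK]] := C2_taylor x0_int (@jet_coordinates R m n) H_Ck H_diff.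
have H_taylor p : nrm (p - ((0, a) : Cx R * 'M[Cx R]_(m, n))) <= r1 -> _ :=
  fun pr => let: And5 _ b c d e := HK p pr in And4 b c d e.
have [rho rho_gt0 [rhoL [U [U0 Ur Ud U1]]]] :=
  vfield_flow r1_gt0 K_ge0 H_taylor (erefl _).
have r2 : 0 < rho / 2 by rewrite divr_gt0.
exists (rho / 2) => // r /andP[r_gt0 r_le].
have r_rho : r < rho by move: r_le rho_gt0; lra.
have UOm z : nrm z <= r -> Omega4 (Ordinal m_gt0) Rstar R' (U z).
  move=> zr; have [|Uz _ _ _ _] := HK (U z); last exact: interior_subset Uz.
  apply: (le_trans (Ur z (le_trans zr (ltW r_rho)))); move: r1_gt0; lra.
split.
  exists (fun z => row (Ordinal m_gt0) (U z).2).
  by apply: (@flow_solution R m n m_gt0 H _ U a r rho) => //; rewrite r_gt0.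
have unique f : holomorphic_solution (Omega4 (Ordinal m_gt0) Rstar R') H a r f ->
    forall z, disc r z -> f z = row (Ordinal m_gt0) (U z).2.
  move=> fsol z /disc_nrm zr; have [_ _ _ f0] := fsol.
  have -> : U z = (z, jet m f z).
    symmetry; apply: (@integral_curve_unique R _ (vfield H) (0, a) r1 (1 + K) rho
      (fun w => (w, jet m f w)) U z) => //.
    - exact: vfield_lipschitz H_taylor.
    - exact: addr_ge0.
    - exact: le_trans zr (ltW r_rho).
    - rewrite U0; congr pair; apply/row_matrixP => i; rewrite -f0.
      by apply/rowP => j; rewrite !mxE.
    - by move=> w wz; apply: Ur; apply: le_trans wz (le_trans zr (ltW r_rho)).
    - by move=> w wz; apply: (solution_flow fsol); apply: le_trans wz zr.
    - by move=> w wz; apply: Ud; apply: le_lt_trans wz (le_lt_trans zr r_rho).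
  by apply/rowP => j; rewrite !mxE.
by move=> f g /unique fU /unique gU z zr; rewrite fU// gU.
Qed.
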